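(* (Verlinde formula.) Let $\mathcal{C}$ be a modular category with simple objects $V_i$, $i\in I$ (with $V_0=1$), fusion coefficients $N_{ij}^k$ and normalized matrix $S$. Then for all $i,j,k\in I$, $$N_{ij}^k=\sum_{r\in I}\frac{S_{ir}\,S_{jr}\,S_{k^*r}}{S_{0r}}.$$
   Context: A ribbon category is a braided monoidal category (strict without loss of generality) with braiding $\sigma$, duals, and a compatible twist $\theta$, i.e. natural isomorphisms $\theta_V:V\to V$ with $\theta_{V\otimes W}=\sigma_{W,V}\sigma_{V,W}(\theta_V\otimes\theta_W)$, $\theta_1=\mathrm{id}$ and $(\theta_V\otimes \mathrm{id}_{V^*})i_V=(\mathrm{id}_V\otimes\theta_{V^*})i_V$, where $i_V:1\to V\otimes V^*$ is the coevaluation. It has a trace $\mathrm{tr}(f)\in\mathrm{End}(1)$ for $f:V\to V$, and $\dim V=\mathrm{tr}(\mathrm{id}_V)$. It is semisimple if it is $\mathbb{C}$-linear abelian, every object is a finite direct sum of simple objects, and $\mathrm{Hom}(V_i,V_j)$ is $\mathbb{C}$ if $i=j$ and $0$ otherwise, where $\{V_i\}_{i\in I}$ are representatives of the isomorphism classes of simple objects. The unit $1=V_0$ is simple, so $\mathrm{End}(1)=\mathbb{C}$. A modular category is a semisimple ribbon category with $I$ finite such that the matrix $s_{ij}=\mathrm{tr}(\sigma_{V_j,V_i}\sigma_{V_i,V_j})\in\mathbb{C}$ (the value of the Hopf link with components labelled $i$ and $j$) is invertible. Write $\theta_{V_i}=\theta_i\,\mathrm{id}$, $\dim(i)=\dim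 V_i$, $p^{\pm}=\sum_{i\in I}\theta_i^{\pm1}\dim(i)^2$, $D=\sqrt{p^+p^-}$ (a fixed choice of square root), and $S_{ij}=\frac1D s_{ij}$. The index $i^*\in I$ is defined by $V_{i^*}\cong V_i^*$. The $N_{ij}^k$ are the nonnegative integers with $V_i\otimes V_j\cong\bigoplus_k N_{ij}^kV_k$. *)

(* Defs.v *)
From mathcomp Require Import all_boot all_order all_algebra.
From mathcomp Require Import boolp classical_sets reals.
From mathcomp Require Import complex.

Set Implicit Arguments.
Unset Strict Implicit.
Unset Printing Implicit Defensive.

Import GRing.Theory.
Local Open Scope ring_scope.

Declare Scope cat_scope.
Delimit Scope cat_scope with cat.
Local Open Scope cat_scope.

Reserved Notation "g ∘ f" (at level 40, left associativity).
Reserved Notation "A ⊗ B" (at level 38, left associativity).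
Reserved Notation "f ⊠ g" (at level 38, left associativity).
Reserved Notation "A ≅ B" (at level 70, no associativity).

Structure linearCategory (K : fieldType) := LinearCategory {
  obj :> Type;
  hom : obj -> obj -> lmodType K;
  idm : forall A, hom A A;
  comph : forall {A B C}, hom B C -> hom A B -> hom A C
    where "g ∘ f" := (comph g f) : cat_scope;
  comp_idl : forall A B (f : hom A B), idm B ∘ f = f;
  comp_idr : forall A B (f : hom A B), f ∘ idm A = f;
  compA : forall A B C D (h : hom C D) (g : hom B C) (f : hom A B),
    h ∘ (g ∘ f) = (h ∘ g) ∘ f;
  comp_linearl : forall A B C (a : K) (g g' : hom B C) (f : hom A B),
    (a *: g + g') ∘ f = a *: (g ∘ f) + g' ∘ f;
  comp_linearr : forall A B C (a : K) (g : hom B C) (f f' : hom A B),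
    g ∘ (a *: f + f') = a *: (g ∘ f) + g ∘ f'
}.

Arguments hom {K l}.
Arguments idm {K l}.
Notation "g ∘ f" := (comph g f) : cat_scope.

Section LinearCategoryTheory.
Context {K : fieldType} {C : linearCategory K}.
Implicit Types A B X : C.

Record iso A B := Iso {
  ihom :> hom A B;
  iinv : hom B A;
  ihomK : iinv ∘ ihom = idm A;
  iinvK : ihom ∘ iinv = idm B
}.

Definition isomorphic A B : Prop := inhabited (iso A B).

Definition is_iso A B (f : hom A B) : Prop := exists u : iso A B, f = u.

Definition is_mono A B (f : hom A B) : Prop :=
  forall X (u v : hom X A), f ∘ u = f ∘ v -> u = v.

Definition is_epi A B (f : hom A B) : Prop :=
  forall X (u v : hom B X), u ∘ f = v ∘ f -> u = v.

Definition is_kernel A B X (f : hom A B) (k : hom X A) : Prop :=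
  f ∘ k = 0 /\
  forall Y (h : hom Y A), f ∘ h = 0 -> exists! u : hom Y X, k ∘ u = h.

Definition is_cokernel A B X (f : hom A B) (q : hom B X) : Prop :=
  q ∘ f = 0 /\
  forall Y (h : hom B Y), h ∘ f = 0 -> exists! u : hom X Y, u ∘ q = h.

(* X is a (bi)product of the finite family F; for empty J, a zero object. *)
Definition is_direct_sum (J : finType) (F : J -> C) X : Prop :=
  exists (inj : forall j, hom (F j) X) (prj : forall j, hom X (F j)),
    [/\ forall j, prj j ∘ inj j = idm (F j),
        forall j l, j != l -> prj l ∘ inj j = 0
      & \sum_j inj j ∘ prj j = idm X].

(* A nonzero object, each subobject of which is zero or everything. *)
Definition simple_obj X : Prop :=
  idm X <> 0 /\ forall A (m : hom A X), is_mono m -> m = 0 \/ is_iso m.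

(* The inverse of c |-> c id, which identifies K with End(X) for X simple;
   the value is 0 if f is not a multiple of id. *)
Definition scalar_of X (f : hom X X) : K :=
  xget 0 [set c : K | f = c *: idm X]%classic.

End LinearCategoryTheory.

Notation "A ≅ B" := (isomorphic A B) : cat_scope.

Record abelian_category (K : fieldType) (C : linearCategory K) : Prop := Abelian {
  has_direct_sums : forall (J : finType) (F : J -> C),
    exists X, is_direct_sum F X;
  has_kernels : forall (A B : C) (f : hom A B),
    exists (X : C) (k : hom X A), is_kernel f k;
  has_cokernels : forall (A B : C) (f : hom A B),
    exists (X : C) (q : hom B X), is_cokernel f q;
  mono_normal : forall (A B : C) (m : hom A B), is_mono m ->
    exists (X : C) (f : hom B X), is_kernel f m;
  epi_normal : forall (A B : C) (e : hom A B), is_epi e ->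
    exists (X : C) (f : hom X A), is_cokernel f e
}.

(* By ss_end, Hom(V_i, V_i) is K via c |-> c id. *)
Record semisimple (K : fieldType) (C : linearCategory K)
    (I : Type) (V : I -> C) : Prop := Semisimple {
  ss_abelian : abelian_category C;
  ss_simple : forall i, simple_obj (V i);
  ss_repr : forall X : C, simple_obj X -> exists i, X ≅ V i;
  ss_inj : forall i j, V i ≅ V j -> i = j;
  ss_decomp : forall X : C, exists (J : finType) (F : J -> C),
    (forall j, simple_obj (F j)) /\ is_direct_sum F X;
  ss_end : forall i, bijective (fun c : K => c *: idm (V i));
  ss_hom0 : forall i j, i <> j -> forall f : hom (V i) (V j), f = 0
}.

(* The associator and unitors are explicit; a strict category is the case
   where they are identities. *)
Structure monoidalCategory (K : fieldType) := MonoidalCategory {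
  mon_cat :> linearCategory K;
  tunit : mon_cat;
  tens : mon_cat -> mon_cat -> mon_cat
    where "A ⊗ B" := (tens A B) : cat_scope;
  tensm : forall {A A' B B' : mon_cat},
    hom A A' -> hom B B' -> hom (A ⊗ B) (A' ⊗ B')
    where "f ⊠ g" := (tensm f g) : cat_scope;
  tensm_id : forall A B : mon_cat, idm A ⊠ idm B = idm (A ⊗ B);
  tensm_comp : forall (A A' A'' B B' B'' : mon_cat)
      (f' : hom A' A'') (f : hom A A') (g' : hom B' B'') (g : hom B B'),
    (f' ∘ f) ⊠ (g' ∘ g) = (f' ⊠ g') ∘ (f ⊠ g);
  tensm_linearl : forall (A A' B B' : mon_cat) (a : K)
      (f f' : hom A A') (g : hom B B'),
    (a *: f + f') ⊠ g = a *: (f ⊠ g) + f' ⊠ g;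
  tensm_linearr : forall (A A' B B' : mon_cat) (a : K)
      (f : hom A A') (g g' : hom B B'),
    f ⊠ (a *: g + g') = a *: (f ⊠ g) + f ⊠ g';
  assoc : forall A B C : mon_cat, iso ((A ⊗ B) ⊗ C) (A ⊗ (B ⊗ C));
  lunit : forall A : mon_cat, iso (tunit ⊗ A) A;
  runit : forall A : mon_cat, iso (A ⊗ tunit) A;
  assoc_nat : forall (A A' B B' C C' : mon_cat)
      (f : hom A A') (g : hom B B') (h : hom C C'),
    assoc A' B' C' ∘ ((f ⊠ g) ⊠ h) = (f ⊠ (g ⊠ h)) ∘ assoc A B C;
  lunit_nat : forall (A B : mon_cat) (f : hom A B),
    lunit B ∘ (idm tunit ⊠ f) = f ∘ lunit A;
  runit_nat : forall (A B : mon_cat) (f : hom A B),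
    runit B ∘ (f ⊠ idm tunit) = f ∘ runit A;
  pentagon : forall A B C D : mon_cat,
    assoc A B (C ⊗ D) ∘ assoc (A ⊗ B) C D =
    (idm A ⊠ assoc B C D) ∘ assoc A (B ⊗ C) D ∘ (assoc A B C ⊠ idm D);
  triangle : forall A B : mon_cat,
    (idm A ⊠ lunit B) ∘ assoc A tunit B = runit A ⊠ idm B
}.

Arguments tunit {K m}.
Arguments assoc {K m}.
Arguments lunit {K m}.
Arguments runit {K m}.
Notation "A ⊗ B" := (tens A B) : cat_scope.
Notation "f ⊠ g" := (tensm f g) : cat_scope.

Structure braidedCategory (K : fieldType) := BraidedCategory {
  br_cat :> monoidalCategory K;
  braid : forall A B : br_cat, iso (A ⊗ B) (B ⊗ A);
  braid_nat : forall (A A' B B' : br_cat) (f : hom A A') (g : hom B B'),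
    braid A' B' ∘ (f ⊠ g) = (g ⊠ f) ∘ braid A B;
  hexagon : forall A B C : br_cat,
    assoc B C A ∘ braid A (B ⊗ C) ∘ assoc A B C =
    (idm B ⊠ braid A C) ∘ assoc B A C ∘ (braid A B ⊠ idm C);
  hexagon_inv : forall A B C : br_cat,
    iinv (assoc C A B) ∘ braid (A ⊗ B) C ∘ iinv (assoc A B C) =
    (braid A C ⊠ idm B) ∘ iinv (assoc A C B) ∘ (idm A ⊠ braid B C)
}.

Arguments braid {K b}.

Structure ribbonCategory (K : fieldType) := RibbonCategory {
  rib_cat :> braidedCategory K;
  dual_obj : rib_cat -> rib_cat;
  coev : forall A : rib_cat, hom tunit (A ⊗ dual_obj A);
  ev : forall A : rib_cat, hom (dual_obj A ⊗ A) tunit;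
  zigzag : forall A : rib_cat,
    runit A ∘ (idm A ⊠ ev A) ∘ assoc A (dual_obj A) A ∘ (coev A ⊠ idm A) =
    lunit A;
  zigzag_dual : forall A : rib_cat,
    lunit (dual_obj A) ∘ (ev A ⊠ idm (dual_obj A))
      ∘ iinv (assoc (dual_obj A) A (dual_obj A))
      ∘ (idm (dual_obj A) ⊠ coev A) =
    runit (dual_obj A);
  twist : forall A : rib_cat, iso A A;
  twist_nat : forall (A B : rib_cat) (f : hom A B), twist B ∘ f = f ∘ twist A;
  twist_tens : forall A B : rib_cat,
    twist (A ⊗ B) = braid B A ∘ braid A B ∘ (twist A ⊠ twist B) :> hom _ _;
  twist_unit : twist tunit = idm tunit :> hom _ _;
  twist_dual : forall A : rib_cat,
    (twist A ⊠ idm (dual_obj A)) ∘ coev A = (idm A ⊠ twist (dual_obj A)) ∘ coev A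
}.

Arguments dual_obj {K r}.
Arguments coev {K r}.
Arguments ev {K r}.
Arguments twist {K r}.

Section Ribbon.
Context {K : fieldType} {C : ribbonCategory K}.

Definition tr (X : C) (f : hom X X) : hom (tunit : C) tunit :=
  ev X ∘ braid X (dual_obj X) ∘ ((twist X ∘ f) ⊠ idm (dual_obj X)) ∘ coev X.

Definition qdim (X : C) : K := scalar_of (tr (idm X)).

Variables (I : finType) (V : I -> C).

Definition s_entry (i j : I) : K :=
  scalar_of (tr (braid (V j) (V i) ∘ braid (V i) (V j))).

Definition s_matrix : 'M[K]_#|I| :=
  \matrix_(a, b) s_entry (enum_val a) (enum_val b).

Definition twist_scalar (i : I) : K := scalar_of (twist (V i)).

Definition p_plus : K := \sum_i twist_scalar i * qdim (V i) ^+ 2.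

Definition p_minus : K := \sum_i (twist_scalar i)^-1 * qdim (V i) ^+ 2.

(* Meant for D a square root of p_plus * p_minus. *)
Definition S_entry (D : K) (i j : I) : K := D^-1 * s_entry i j.

(* The summand indexed by the pair (k, c) is the c-th copy of V_k. *)
Definition fusion_coefficients (N : I -> I -> I -> nat) : Prop :=
  forall i j, is_direct_sum (J := {k : I & 'I_(N i j k)})
    (fun x => V (tag x)) (V i ⊗ V j).

End Ribbon.

Record modular (K : fieldType) (C : ribbonCategory K)
    (I : finType) (V : I -> C) (i0 : I) : Prop := Modular {
  mod_semisimple : semisimple V;
  mod_unit : V i0 = tunit;
  mod_invertible : s_matrix V \in unitmx
}.

(* Main.v *)
(** Every object is written right nested, A ⊗ (B ⊗ (... ⊗ Z)), and braiding,
    coevaluation and evaluation become families natural in the tail Z (sw, cup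
    and cap).  In this form the associators and unitors disappear once the
    hexagons and zigzags have been rephrased, and string diagrams can be moved
    around as in a strict category.

    Encircling the strand V_r by a loop labelled i is multiplication by
    s_ir / d_r, and is multiplicative in i; so N_i is diagonalised by s, and
    N_ij^k = sum_r s_ir s_jr / d_r (s^-1)_rk.  The case k = 0, where
    N_ij^0 = [j = star i] by duality, gives (s^-1)_rk = a s_(star k, r) with a
    constant a, using d_(star i) = d_i.  Finally the balancing equation
    theta_i theta_j s_ij = sum_k N_ij^k theta_k d_k yields
    sum_j theta_j d_j s_ij = theta_i^-1 d_i p^+, whence p^+ p^- = 1 / a. *)

From mathcomp Require Import all_boot all_order all_algebra.
From mathcomp Require Import boolp classical_sets reals complex ring.
(* Imported last: hom is also a notion of mathcomp.algebra.vector. *)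
Require Import Defs.

Set Implicit Arguments.
Unset Strict Implicit.
Unset Printing Implicit Defensive.

Import GRing.Theory.
Local Open Scope ring_scope.
Local Open Scope cat_scope.

Reserved Notation "A ◁ f" (at level 34, right associativity).
Reserved Notation "f ▷ Z" (at level 33, left associativity).
Notation "A ◁ f" := (idm A ⊠ f) : cat_scope.
Notation "f ▷ Z" := (f ⊠ idm Z) : cat_scope.

(** * Composition in a linear category: rewriting under a prefix, bilinearity *)

Section Composition.
Context {K : fieldType} {C : linearCategory K}.
Implicit Types A B D E F G H : C.

(** Composites are associated to the left, so a run of factors preceded by another factor [x] is not
    a subterm. This lemma and its longer versions let an equation between runs be applied behind
    [x]. *)
Lemma comp_pre2 A B D E (g : hom B D) (f : hom A B) h (x : hom D E) :
  g ∘ f = h -> x ∘ g ∘ f = x ∘ h.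
Proof. by move=> <-; rewrite !compA. Qed.

Lemma comp_pre3 A B D E F (a : hom D E) (b : hom B D) (c : hom A B) h
    (x : hom E F) :
  a ∘ b ∘ c = h -> x ∘ a ∘ b ∘ c = x ∘ h.
Proof. by move=> <-; rewrite !compA. Qed.

Lemma comp_pre4 A B D E F G (a : hom E F) (b : hom D E) (c : hom B D)
    (d : hom A B) h (x : hom F G) :
  a ∘ b ∘ c ∘ d = h -> x ∘ a ∘ b ∘ c ∘ d = x ∘ h.
Proof. by move=> <-; rewrite !compA. Qed.

Lemma comp_pre5 A B D E F G H (a : hom F G) (b : hom E F) (c : hom D E)
    (d : hom B D) (e : hom A B) h (x : hom G H) :
  a ∘ b ∘ c ∘ d ∘ e = h -> x ∘ a ∘ b ∘ c ∘ d ∘ e = x ∘ h.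
Proof. by move=> <-; rewrite !compA. Qed.

Lemma iso_cancell A B D (u : iso B D) (f g : hom A B) :
  u ∘ f = u ∘ g -> f = g.
Proof.
by move=> e; rewrite -[f]comp_idl -[g]comp_idl -(ihomK u) -!compA e.
Qed.

Lemma iso_cancelr A B D (u : iso A B) (f g : hom B D) :
  f ∘ u = g ∘ u -> f = g.
Proof.
by move=> e; rewrite -[f]comp_idr -[g]comp_idr -(iinvK u) !compA e.
Qed.

Lemma comp0l A B D (f : hom A B) : (0 : hom B D) ∘ f = 0.
Proof.
by have := comp_linearl (-1) (0 : hom B D) 0 f; rewrite scaler0 addr0 scaleN1r addNr.
Qed.

Lemma comp0r A B D (f : hom B D) : f ∘ (0 : hom A B) = 0.
Proof.
by have := comp_linearr (-1) f (0 : hom A B) 0; rewrite scaler0 addr0 scaleN1r addNr.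
Qed.

Lemma compDl A B D (g g' : hom B D) (f : hom A B) :
  (g + g') ∘ f = g ∘ f + g' ∘ f.
Proof. by rewrite -[g in LHS]scale1r comp_linearl scale1r. Qed.

Lemma compDr A B D (g : hom B D) (f f' : hom A B) :
  g ∘ (f + f') = g ∘ f + g ∘ f'.
Proof. by rewrite -[f in LHS]scale1r comp_linearr scale1r. Qed.

Lemma compZl A B D c (g : hom B D) (f : hom A B) : (c *: g) ∘ f = c *: (g ∘ f).
Proof. by rewrite -[c *: g]addr0 comp_linearl comp0l addr0. Qed.

Lemma compZr A B D c (g : hom B D) (f : hom A B) : g ∘ (c *: f) = c *: (g ∘ f).
Proof. by rewrite -[c *: f]addr0 comp_linearr comp0r addr0. Qed.

Lemma comp_suml (J : finType) A B D (g : J -> hom B D) (f : hom A B) :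
  (\sum_j g j) ∘ f = \sum_j (g j ∘ f).
Proof.
by apply: (big_morph (fun g => g ∘ f)) => [x y|]; rewrite ?compDl ?comp0l.
Qed.

Lemma comp_sumr (J : finType) A B D (g : hom B D) (f : J -> hom A B) :
  g ∘ (\sum_j f j) = \sum_j (g ∘ f j).
Proof.
by apply: (big_morph (fun f => g ∘ f)) => [x y|]; rewrite ?compDr ?comp0r.
Qed.

End Composition.

(** * Whiskering, bilinearity of the tensor product, and constructions of isomorphisms *)

Section Monoidal.
Context {K : fieldType} {C : monoidalCategory K}.
Implicit Types A B D E X Y Z W : C.

Lemma whiskl_comp A X Y Z (g : hom Y Z) (f : hom X Y) :
  A ◁ (g ∘ f) = (A ◁ g) ∘ (A ◁ f).
Proof. by rewrite -tensm_comp comp_idl. Qed.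

Lemma whiskr_comp A X Y Z (g : hom Y Z) (f : hom X Y) :
  (g ∘ f) ▷ A = (g ▷ A) ∘ (f ▷ A).
Proof. by rewrite -tensm_comp comp_idl. Qed.

Lemma whisk_exch A B X Y (f : hom A B) (g : hom X Y) :
  (f ▷ Y) ∘ (A ◁ g) = (B ◁ g) ∘ (f ▷ X).
Proof. by rewrite -!tensm_comp !comp_idl !comp_idr. Qed.

Lemma tensm0r A B X Y (f : hom A B) : f ⊠ (0 : hom X Y) = 0.
Proof.
by have := tensm_linearr (-1) f (0 : hom X Y) 0; rewrite scaler0 addr0 scaleN1r addNr.
Qed.

Lemma tensm0l A B X Y (f : hom A B) : (0 : hom X Y) ⊠ f = 0.
Proof.
by have := tensm_linearl (-1) (0 : hom X Y) 0 f; rewrite scaler0 addr0 scaleN1r addNr.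
Qed.

Lemma tensmDr A B X Y (f : hom A B) (g g' : hom X Y) :
  f ⊠ (g + g') = f ⊠ g + f ⊠ g'.
Proof. by rewrite -[g in LHS]scale1r tensm_linearr scale1r. Qed.

Lemma tensmDl A B X Y (f : hom A B) (g g' : hom X Y) :
  (g + g') ⊠ f = g ⊠ f + g' ⊠ f.
Proof. by rewrite -[g in LHS]scale1r tensm_linearl scale1r. Qed.

Lemma tensmZr A B X Y c (f : hom A B) (g : hom X Y) :
  f ⊠ (c *: g) = c *: (f ⊠ g).
Proof. by rewrite -[c *: g]addr0 tensm_linearr tensm0r addr0. Qed.

Lemma tensmZl A B X Y c (f : hom A B) (g : hom X Y) :
  (c *: g) ⊠ f = c *: (g ⊠ f).
Proof. by rewrite -[c *: g]addr0 tensm_linearl tensm0l addr0. Qed.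

Lemma tensm_sumr (J : finType) A B X Y (f : hom A B) (g : J -> hom X Y) :
  f ⊠ (\sum_j g j) = \sum_j (f ⊠ g j).
Proof. by apply: (big_morph (fun g => f ⊠ g)) => [x y|]; rewrite ?tensmDr ?tensm0r. Qed.

Lemma tensm_suml (J : finType) A B X Y (f : hom A B) (g : J -> hom X Y) :
  (\sum_j g j) ⊠ f = \sum_j (g j ⊠ f).
Proof. by apply: (big_morph (fun g => g ⊠ f)) => [x y|]; rewrite ?tensmDl ?tensm0l. Qed.

Definition whiskl_iso A X Y (u : iso X Y) : iso (A ⊗ X) (A ⊗ Y).
Proof.
exists (A ◁ u) (A ◁ iinv u).
- by rewrite -whiskl_comp ihomK tensm_id.
- by rewrite -whiskl_comp iinvK tensm_id.
Defined.

Definition whiskr_iso A X Y (u : iso X Y) : iso (X ⊗ A) (Y ⊗ A).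
Proof.
exists (u ▷ A) (iinv u ▷ A).
- by rewrite -whiskr_comp ihomK tensm_id.
- by rewrite -whiskr_comp iinvK tensm_id.
Defined.

Definition comp_iso X Y Z (v : iso Y Z) (u : iso X Y) : iso X Z.
Proof.
exists (v ∘ u) (iinv u ∘ iinv v).
- by rewrite -compA (compA (iinv v)) ihomK comp_idl ihomK.
- by rewrite -compA (compA u) iinvK comp_idl iinvK.
Defined.

Definition inv_iso X Y (u : iso X Y) : iso Y X :=
  Iso (iinvK u) (ihomK u).

End Monoidal.

(* Rewrites with e where its left-hand side occurs as a run of consecutive
   factors of a composite, after distributing whiskering over composition. *)
Ltac chain e :=
  let H := fresh "H" in
  pose proof e as H; cbv beta in H;
  rewrite ?(whiskl_comp, whiskr_comp) ?compA in H;
  rewrite ?(whiskl_comp, whiskr_comp) ?compA;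
  first [ rewrite H | rewrite (comp_pre2 _ H) | rewrite (comp_pre3 _ H)
        | rewrite (comp_pre4 _ H) | rewrite (comp_pre5 _ H) ];
  rewrite ?tensm_id ?comp_idl ?comp_idr ?(whiskl_comp, whiskr_comp) ?compA;
  clear H.

(** * Coherence of associators and unitors *)

Section Coherence.
Context {K : fieldType} {C : monoidalCategory K}.
Implicit Types A B D E X Y Z W : C.

Lemma whiskl_unit_inj X Y (f g : hom X Y) :
  tunit ◁ f = tunit ◁ g -> f = g.
Proof.
by move=> e; apply: (iso_cancelr (u := lunit X)); rewrite -!lunit_nat e.
Qed.

Lemma whiskr_unit_inj X Y (f g : hom X Y) :
  f ▷ tunit = g ▷ tunit -> f = g.
Proof.
by move=> e; apply: (iso_cancelr (u := runit X)); rewrite -!runit_nat e.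
Qed.

Lemma assoc_natl A A' B Z (f : hom A A') :
  assoc A' B Z ∘ (f ▷ B ▷ Z) = (f ▷ (B ⊗ Z)) ∘ assoc A B Z.
Proof. by rewrite assoc_nat tensm_id. Qed.

Lemma assoc_natm A B B' Z (f : hom B B') :
  assoc A B' Z ∘ ((A ◁ f) ▷ Z) = (A ◁ f ▷ Z) ∘ assoc A B Z.
Proof. by rewrite assoc_nat. Qed.

Lemma assoc_natr A B Z Z' (f : hom Z Z') :
  assoc A B Z' ∘ ((A ⊗ B) ◁ f) = (A ◁ B ◁ f) ∘ assoc A B Z.
Proof. by rewrite -tensm_id assoc_nat. Qed.

(** Kelly's consequence of the axioms: whiskered with [tunit] on the left, the equation follows from
    one pentagon and two triangles, and that whiskering is injective. *)
Lemma lunit_tens A B : lunit (A ⊗ B) ∘ assoc tunit A B = lunit A ▷ B.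
Proof.
apply: whiskl_unit_inj.
apply: (iso_cancelr (u := assoc tunit (tunit ⊗ A) B)).
apply: (iso_cancelr (u := whiskr_iso B (assoc tunit tunit A))) => /=.
rewrite whiskl_comp -!compA [in LHS](compA (tunit ◁ assoc _ _ _)) -pentagon.
rewrite compA triangle -assoc_natl -triangle whiskr_comp.
by rewrite !compA assoc_natm.
Qed.

Lemma pentagon_inv A B D Z :
  (A ◁ assoc B D Z) ∘ assoc A (B ⊗ D) Z =
  assoc A B (D ⊗ Z) ∘ assoc (A ⊗ B) D Z ∘ (iinv (assoc A B D) ▷ Z).
Proof.
chain (pentagon A B D Z).
by chain (congr1 (fun f => f ▷ Z) (iinvK (assoc A B D))).
Qed.

End Coherence.

(** * Crossings of adjacent strands in nested form *)

Section Braided.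
Context {K : fieldType} {C : braidedCategory K}.
Implicit Types A B D E X Y Z W : C.

(* Locked, so that rewriting with compA does not look inside. *)
Definition sw : forall A B Z, iso (A ⊗ (B ⊗ Z)) (B ⊗ (A ⊗ Z)) :=
  locked (fun A B Z => comp_iso (assoc B A Z)
    (comp_iso (whiskr_iso Z (braid A B)) (inv_iso (assoc A B Z)))).

Lemma sw_assoc A B Z : sw A B Z ∘ assoc A B Z = assoc B A Z ∘ (braid A B ▷ Z).
Proof. by rewrite /sw -lock /= -!compA ihomK comp_idr. Qed.

Lemma sw_natl A A' B Z (f : hom A A') :
  sw A' B Z ∘ (f ▷ (B ⊗ Z)) = (B ◁ f ▷ Z) ∘ sw A B Z.
Proof.
apply: (iso_cancelr (u := assoc A B Z)).
chain (esym (assoc_natl B Z f)); chain (sw_assoc A' B Z).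
chain (congr1 (fun f => f ▷ Z) (braid_nat f (idm B))).
by chain (sw_assoc A B Z); chain (esym (assoc_natm B Z f)).
Qed.

Lemma sw_natm A B B' Z (f : hom B B') :
  sw A B' Z ∘ (A ◁ f ▷ Z) = (f ▷ (A ⊗ Z)) ∘ sw A B Z.
Proof.
apply: (iso_cancelr (u := assoc A B Z)).
chain (esym (assoc_natm A Z f)); chain (sw_assoc A B' Z).
chain (congr1 (fun f => f ▷ Z) (braid_nat (idm A) f)).
by chain (sw_assoc A B Z); chain (esym (assoc_natl A Z f)).
Qed.

Lemma sw_nat A B Z Z' (f : hom Z Z') :
  sw A B Z' ∘ (A ◁ B ◁ f) = (B ◁ A ◁ f) ∘ sw A B Z.
Proof.
apply: (iso_cancelr (u := assoc A B Z)).
chain (esym (assoc_natr A B f)); chain (sw_assoc A B Z').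
chain (whisk_exch (braid A B) f).
by chain (assoc_natr B A f); chain (sw_assoc A B Z).
Qed.

(** The first hexagon in nested form: pentagons strip the associators off the tail, leaving
    [hexagon D A B] whiskered by [Z]. *)
Lemma sw_tensr D A B Z :
  (A ◁ sw D B Z) ∘ sw D A (B ⊗ Z) ∘ (D ◁ assoc A B Z) =
  assoc A B (D ⊗ Z) ∘ sw D (A ⊗ B) Z.
Proof.
apply: (iso_cancelr (u := assoc D (A ⊗ B) Z)).
apply: (iso_cancelr (u := whiskr_iso Z (assoc D A B))) => /=.
chain (esym (pentagon D A B Z)).
chain (sw_assoc D A (B ⊗ Z)).
chain (esym (assoc_natl B Z (braid D A))).
chain (pentagon A D B Z).
chain (congr1 (fun f => A ◁ f) (sw_assoc D B Z)).
chain (esym (assoc_natm A Z (braid D B))).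
chain (sw_assoc D (A ⊗ B) Z).
chain (pentagon A B D Z).
chain (congr1 (fun f => f ▷ Z) (hexagon D A B)).
by [].
Qed.

Lemma sw_tensl A B D Z :
  sw A D (B ⊗ Z) ∘ (A ◁ sw B D Z) ∘ assoc A B (D ⊗ Z) =
  (D ◁ assoc A B Z) ∘ sw (A ⊗ B) D Z.
Proof.
(* The second hexagon solved for the braiding of [A ⊗ B] with [D], which removes the inverse outer
   associators. *)
have hex : braid (A ⊗ B) D = assoc D A B ∘ (braid A D ▷ B) ∘
    iinv (assoc A D B) ∘ (A ◁ braid B D) ∘ assoc A B D :> hom _ _.
  chain (esym (hexagon_inv A B D)); chain (iinvK (assoc D A B)).
  by chain (ihomK (assoc A B D)).
apply: (iso_cancelr (u := assoc (A ⊗ B) D Z)).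
chain (pentagon A B D Z).
chain (congr1 (fun f => A ◁ f) (sw_assoc B D Z)).
chain (esym (assoc_natm A Z (braid B D))).
chain (pentagon_inv A D B Z).
chain (sw_assoc A D (B ⊗ Z)).
chain (esym (assoc_natl B Z (braid A D))).
chain (pentagon D A B Z).
chain (sw_assoc (A ⊗ B) D Z).
by chain (congr1 (fun f => f ▷ Z) hex).
Qed.

(** Crossing [tunit ⊗ tunit] is crossing [tunit] twice, but merging the two units by [lunit] turns
    it into a single crossing; cancelling one crossing leaves a trivial one. This works for tails
    [tunit ⊗ Y], and naturality along [lunit Z] reaches every tail. *)
Lemma sw_unitr D Z : lunit (D ⊗ Z) ∘ sw D tunit Z = D ◁ lunit Z.
Proof.
have swU Y : lunit (D ⊗ (tunit ⊗ Y)) ∘ sw D tunit (tunit ⊗ Y) =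
    D ◁ lunit (tunit ⊗ Y).
  apply: (iso_cancell (u := sw D tunit Y)).
  apply: (iso_cancelr (u := whiskl_iso D (assoc tunit tunit Y))) => /=.
  chain (esym (lunit_nat (sw D tunit Y))).
  chain (sw_tensr D tunit tunit Y).
  chain (lunit_tens tunit (D ⊗ Y)).
  chain (esym (sw_natm D Y (lunit tunit))).
  by chain (congr1 (fun f => D ◁ f) (lunit_tens tunit Y)).
apply: (iso_cancelr (u := whiskl_iso D (whiskl_iso tunit (lunit Z)))) => /=.
chain (sw_nat D tunit (lunit Z)).
chain (lunit_nat (D ◁ lunit Z)).
chain (swU Z).
by chain (congr1 (fun f => D ◁ f) (lunit_nat (lunit Z))).
Qed.

Lemma sw_unitl D Z : (D ◁ lunit Z) ∘ sw tunit D Z = lunit (D ⊗ Z).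
Proof.
have swU Y : (D ◁ lunit (tunit ⊗ Y)) ∘ sw tunit D (tunit ⊗ Y) =
    lunit (D ⊗ (tunit ⊗ Y)).
  apply: (iso_cancelr (u := whiskl_iso tunit (sw tunit D Y))) => /=.
  apply: (iso_cancelr (u := assoc tunit tunit (D ⊗ Y))) => /=.
  chain (sw_tensl tunit tunit D Y).
  chain (congr1 (fun f => D ◁ f) (lunit_tens tunit Y)).
  chain (esym (sw_natl D Y (lunit tunit))).
  chain (lunit_nat (sw tunit D Y)).
  by chain (lunit_tens tunit (D ⊗ Y)).
apply: (iso_cancelr (u := whiskl_iso tunit (whiskl_iso D (lunit Z)))) => /=.
chain (sw_nat tunit D (lunit Z)).
chain (lunit_nat (D ◁ lunit Z)).
rewrite -(swU Z) !compA; congr (_ ∘ _).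
by chain (congr1 (fun f => D ◁ f) (lunit_nat (lunit Z))).
Qed.

(** Each side carries [A ⊗ B] past [D] as one strand, with [A] and [B] crossed after or before;
    naturality of the crossing along [braid A B] identifies the two. *)
Lemma yang_baxter A B D Z :
  (D ◁ sw A B Z) ∘ sw A D (B ⊗ Z) ∘ (A ◁ sw B D Z) =
  sw B D (A ⊗ Z) ∘ (B ◁ sw A D Z) ∘ sw A B (D ⊗ Z).
Proof.
apply: (iso_cancelr (u := assoc A B (D ⊗ Z))).
chain (sw_tensl A B D Z).
chain (congr1 (fun f => D ◁ f) (sw_assoc A B Z)).
chain (esym (sw_natl D Z (braid A B))).
chain (sw_assoc A B (D ⊗ Z)).
by chain (sw_tensl B A D Z).
Qed.

Lemma sw_tail A B Z W :
  sw A B (Z ⊗ W) ∘ (A ◁ assoc B Z W) ∘ assoc A (B ⊗ Z) W =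
  (B ◁ assoc A Z W) ∘ assoc B (A ⊗ Z) W ∘ (sw A B Z ▷ W).
Proof.
apply: (iso_cancelr (u := whiskr_iso W (assoc A B Z))) => /=.
chain (esym (pentagon A B Z W)).
chain (sw_assoc A B (Z ⊗ W)).
chain (esym (assoc_natl Z W (braid A B))).
chain (congr1 (fun f => f ▷ W) (sw_assoc A B Z)).
by chain (pentagon B A Z W).
Qed.

End Braided.

(** * Cups, caps and twists in nested form, and strands sliding past them *)

Section Ribbon.
Context {K : fieldType} {C : ribbonCategory K}.
Implicit Types A B D E X Y Z W : C.

Definition cup : forall A Z, hom Z (A ⊗ (dual_obj A ⊗ Z)) :=
  locked (fun A Z => assoc A (dual_obj A) Z ∘ (coev A ▷ Z) ∘ iinv (lunit Z)).

Definition cap : forall A Z, hom (dual_obj A ⊗ (A ⊗ Z)) Z :=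
  locked (fun A Z => lunit Z ∘ (ev A ▷ Z) ∘ iinv (assoc (dual_obj A) A Z)).

Lemma cupE A Z : cup A Z ∘ lunit Z = assoc A (dual_obj A) Z ∘ (coev A ▷ Z).
Proof. by rewrite /cup -lock; chain (ihomK (lunit Z)). Qed.

Lemma capE A Z : cap A Z ∘ assoc (dual_obj A) A Z = lunit Z ∘ (ev A ▷ Z).
Proof. by rewrite /cap -lock; chain (ihomK (assoc (dual_obj A) A Z)). Qed.

Lemma cup_nat A Z Z' (f : hom Z Z') :
  cup A Z' ∘ f = (A ◁ dual_obj A ◁ f) ∘ cup A Z.
Proof.
apply: (iso_cancelr (u := lunit Z)).
chain (esym (lunit_nat f)); chain (cupE A Z'); chain (cupE A Z).
chain (whisk_exch (coev A) f).
by chain (assoc_natr A (dual_obj A) f).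
Qed.

Lemma cap_nat A Z Z' (f : hom Z Z') :
  cap A Z' ∘ (dual_obj A ◁ A ◁ f) = f ∘ cap A Z.
Proof.
apply: (iso_cancelr (u := assoc (dual_obj A) A Z)).
chain (esym (assoc_natr (dual_obj A) A f)).
chain (capE A Z'); chain (capE A Z).
chain (whisk_exch (ev A) f).
by chain (lunit_nat f).
Qed.

Lemma zig A Z : (A ◁ cap A Z) ∘ cup A (A ⊗ Z) = idm (A ⊗ Z).
Proof.
apply: (iso_cancelr (u := lunit (A ⊗ Z))).
apply: (iso_cancelr (u := assoc tunit A Z)).
chain (cupE A (A ⊗ Z)).
chain (esym (assoc_natl A Z (coev A))).
chain (pentagon A (dual_obj A) A Z).
chain (congr1 (fun f => A ◁ f) (capE A Z)).
chain (esym (assoc_natm A Z (ev A))).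
chain (triangle A Z).
chain (congr1 (fun f => f ▷ Z) (zigzag A)).
by chain (lunit_tens A Z).
Qed.

Lemma zag A Z :
  cap A (dual_obj A ⊗ Z) ∘ (dual_obj A ◁ cup A Z) = idm (dual_obj A ⊗ Z).
Proof.
apply: (iso_cancelr (u := whiskl_iso (dual_obj A) (lunit Z))) => /=.
apply: (iso_cancelr (u := assoc (dual_obj A) tunit Z)).
chain (congr1 (fun f => dual_obj A ◁ f) (cupE A Z)).
chain (esym (assoc_natm (dual_obj A) Z (coev A))).
chain (pentagon_inv (dual_obj A) A (dual_obj A) Z).
chain (capE A (dual_obj A ⊗ Z)).
chain (esym (assoc_natl (dual_obj A) Z (ev A))).
chain (lunit_tens (dual_obj A) Z).
chain (congr1 (fun f => f ▷ Z) (zigzag_dual A)).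
by chain (triangle (dual_obj A) Z).
Qed.

(** By naturality along [coev A], crossing both legs of the cup amounts to crossing the unit object,
    which is trivial. The next two lemmas hold for the same reason. *)
Lemma cup_sw_over A B Z :
  (A ◁ sw B (dual_obj A) Z) ∘ sw B A (dual_obj A ⊗ Z) ∘ (B ◁ cup A Z) =
  cup A (B ⊗ Z).
Proof.
apply: (iso_cancelr (u := whiskl_iso B (lunit Z))) => /=.
chain (congr1 (fun f => B ◁ f) (cupE A Z)).
chain (sw_tensr B A (dual_obj A) Z).
chain (sw_natm B Z (coev A)).
chain (esym (cupE A (B ⊗ Z))).
by chain (sw_unitr B Z).
Qed.

Lemma cup_sw_under A B Z :
  sw A B (dual_obj A ⊗ Z) ∘ (A ◁ sw (dual_obj A) B Z) ∘ cup A (B ⊗ Z) =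
  B ◁ cup A Z.
Proof.
apply: (iso_cancelr (u := lunit (B ⊗ Z))).
chain (cupE A (B ⊗ Z)).
chain (sw_tensl A (dual_obj A) B Z).
chain (sw_natl B Z (coev A)).
chain (congr1 (fun f => B ◁ f) (esym (cupE A Z))).
by chain (sw_unitl B Z).
Qed.

Lemma cap_sw_over A B Z :
  cap A (B ⊗ Z) ∘ (dual_obj A ◁ sw B A Z) ∘ sw B (dual_obj A) (A ⊗ Z) =
  B ◁ cap A Z.
Proof.
apply: (iso_cancelr (u := whiskl_iso B (assoc (dual_obj A) A Z))) => /=.
chain (sw_tensr B (dual_obj A) A Z).
chain (capE A (B ⊗ Z)).
chain (esym (sw_natm B Z (ev A))).
chain (sw_unitr B Z).
by chain (congr1 (fun f => B ◁ f) (capE A Z)).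
Qed.

Lemma cup_tail A Z W :
  (A ◁ assoc (dual_obj A) Z W) ∘ assoc A (dual_obj A ⊗ Z) W ∘ (cup A Z ▷ W) =
  cup A (Z ⊗ W).
Proof.
apply: (iso_cancelr (u := whiskr_iso W (lunit Z))) => /=.
chain (congr1 (fun f => f ▷ W) (cupE A Z)).
chain (esym (pentagon A (dual_obj A) Z W)).
chain (assoc_natl Z W (coev A)).
chain (esym (cupE A (Z ⊗ W))).
by chain (lunit_tens Z W).
Qed.

Lemma cap_tail A Z W :
  cap A (Z ⊗ W) ∘ (dual_obj A ◁ assoc A Z W) ∘ assoc (dual_obj A) (A ⊗ Z) W =
  cap A Z ▷ W.
Proof.
apply: (iso_cancelr (u := whiskr_iso W (assoc (dual_obj A) A Z))) => /=.
chain (esym (pentagon (dual_obj A) A Z W)).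
chain (capE A (Z ⊗ W)).
chain (esym (assoc_natl Z W (ev A))).
chain (lunit_tens Z W).
by chain (congr1 (fun f => f ▷ W) (capE A Z)).
Qed.

Lemma twist_tens_strand A B Z :
  assoc A B Z ∘ (twist (A ⊗ B) ▷ Z) =
  sw B A Z ∘ sw A B Z ∘ (twist A ▷ (B ⊗ Z)) ∘ (A ◁ twist B ▷ Z) ∘ assoc A B Z.
Proof.
have tw : twist (A ⊗ B) =
    braid B A ∘ braid A B ∘ (twist A ▷ B) ∘ (A ◁ twist B) :> hom _ _.
  rewrite twist_tens -!compA; congr (_ ∘ (_ ∘ _)).
  by rewrite -tensm_comp comp_idl comp_idr.
chain (congr1 (fun f => f ▷ Z) tw).
chain (esym (assoc_natm A Z (twist B))).
chain (esym (assoc_natl B Z (twist A))).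
by chain (sw_assoc A B Z); chain (sw_assoc B A Z).
Qed.

Lemma twist_cup A Z :
  (twist A ▷ (dual_obj A ⊗ Z)) ∘ cup A Z =
  (A ◁ twist (dual_obj A) ▷ Z) ∘ cup A Z.
Proof.
apply: (iso_cancelr (u := lunit Z)).
chain (cupE A Z); chain (cupE A Z).
chain (esym (assoc_natl (dual_obj A) Z (twist A))).
chain (esym (assoc_natm A Z (twist (dual_obj A)))).
by chain (congr1 (fun f => f ▷ Z) (twist_dual A)).
Qed.

(* The right-handed evaluation X ⊗ X^* -> 1, without the twist. *)
Definition bcap : forall A Z, hom (A ⊗ (dual_obj A ⊗ Z)) Z :=
  locked (fun A Z => cap A Z ∘ sw A (dual_obj A) Z).

Lemma bcapE A Z : bcap A Z = cap A Z ∘ sw A (dual_obj A) Z.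
Proof. by rewrite /bcap -lock. Qed.

Lemma bcap_nat A Z Z' (f : hom Z Z') :
  bcap A Z' ∘ (A ◁ dual_obj A ◁ f) = f ∘ bcap A Z.
Proof.
by rewrite !bcapE; chain (sw_nat A (dual_obj A) f); chain (cap_nat A f).
Qed.

Lemma bcap_sw_over A B Z :
  bcap A (B ⊗ Z) ∘ (A ◁ sw B (dual_obj A) Z) ∘ sw B A (dual_obj A ⊗ Z) =
  B ◁ bcap A Z.
Proof.
rewrite !bcapE.
chain (esym (yang_baxter B A (dual_obj A) Z)).
by chain (cap_sw_over A B Z).
Qed.

(** With the twist included, this is the right-handed evaluation that closes the strand in [tr]. *)
Definition tcap : forall A Z, hom (A ⊗ (dual_obj A ⊗ Z)) Z :=
  locked (fun A Z => bcap A Z ∘ (twist A ▷ (dual_obj A ⊗ Z))).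

Lemma tcapE A Z : tcap A Z = bcap A Z ∘ (twist A ▷ (dual_obj A ⊗ Z)).
Proof. by rewrite /tcap -lock. Qed.

Lemma tcap_nat A Z Z' (f : hom Z Z') :
  tcap A Z' ∘ (A ◁ dual_obj A ◁ f) = f ∘ tcap A Z.
Proof.
by rewrite !tcapE; chain (whisk_exch (twist A) (dual_obj A ◁ f)); chain (bcap_nat A f).
Qed.

Lemma tcap_sw_over A B Z :
  tcap A (B ⊗ Z) ∘ (A ◁ sw B (dual_obj A) Z) ∘ sw B A (dual_obj A ⊗ Z) =
  B ◁ tcap A Z.
Proof.
rewrite !tcapE.
chain (whisk_exch (twist A) (sw B (dual_obj A) Z)).
chain (esym (sw_natm B (dual_obj A ⊗ Z) (twist A))).
by chain (bcap_sw_over A B Z).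
Qed.

Lemma tcap_tail A Z W :
  tcap A (Z ⊗ W) ∘ (A ◁ assoc (dual_obj A) Z W) ∘ assoc A (dual_obj A ⊗ Z) W =
  tcap A Z ▷ W.
Proof.
rewrite !tcapE !bcapE.
chain (whisk_exch (twist A) (assoc (dual_obj A) Z W)).
chain (esym (assoc_natl (dual_obj A ⊗ Z) W (twist A))).
chain (sw_tail A (dual_obj A) Z W).
by chain (cap_tail A Z W).
Qed.

End Ribbon.

(** * Mates of natural families with respect to adjoint strands *)

(* For an adjoint pair of "strands" F, G with cup' : Id -> FG, cap' : GF -> Id and
   a natural f : A ⊗ - -> F, the mate of f is the family G -> A^* ⊗ -. *)
Section Mate.
Context {K : fieldType} {C : ribbonCategory K}.
Implicit Types X Y Z W : C.
Variables (A : C) (F G : C -> C).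
Variables (Fm : forall Z W, hom Z W -> hom (F Z) (F W)).
Variables (Gm : forall Z W, hom Z W -> hom (G Z) (G W)).
Variables (cup' : forall Z, hom Z (F (G Z))) (cap' : forall Z, hom (G (F Z)) Z).
Variables (f : forall Z, hom (A ⊗ Z) (F Z)).
Variables (sF : forall Z, hom (A ⊗ F Z) (F (A ⊗ Z))).
Variables (sG : forall Z, hom (A ⊗ G Z) (G (A ⊗ Z))).

Hypothesis Fm_comp : forall X Y Z (g : hom Y Z) (h : hom X Y),
  Fm (g ∘ h) = Fm g ∘ Fm h.
Hypothesis Gm_comp : forall X Y Z (g : hom Y Z) (h : hom X Y),
  Gm (g ∘ h) = Gm g ∘ Gm h.
Hypothesis Gm_id : forall Z, Gm (idm Z) = idm (G Z).
Hypothesis cup'_nat : forall Z W (h : hom Z W),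
  cup' W ∘ h = Fm (Gm h) ∘ cup' Z.
Hypothesis cap'_nat : forall Z W (h : hom Z W),
  cap' W ∘ Gm (Fm h) = h ∘ cap' Z.
Hypothesis zig' : forall Z, Fm (cap' Z) ∘ cup' (F Z) = idm (F Z).
Hypothesis f_nat : forall Z W (h : hom Z W), f W ∘ (A ◁ h) = Fm h ∘ f Z.
Hypothesis f_sw : forall Z, f (A ⊗ Z) ∘ sw A A Z = sF Z ∘ (A ◁ f Z).
Hypothesis sG_nat : forall Z W (h : hom Z W),
  sG W ∘ (A ◁ Gm h) = Gm (A ◁ h) ∘ sG Z.
Hypothesis cap'_sw : forall Z,
  cap' (A ⊗ Z) ∘ Gm (sF Z) ∘ sG (F Z) = A ◁ cap' Z.

Definition mate Z : hom (G Z) (dual_obj A ⊗ Z) :=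
  cap' (dual_obj A ⊗ Z) ∘ Gm (f (dual_obj A ⊗ Z)) ∘ Gm (cup A Z).

Lemma mate_cup Z : f (dual_obj A ⊗ Z) ∘ cup A Z = Fm (mate Z) ∘ cup' Z.
Proof.
rewrite /mate !Fm_comp.
chain (esym (cup'_nat (cup A Z))).
chain (esym (cup'_nat (f (dual_obj A ⊗ Z)))).
by chain (zig' (dual_obj A ⊗ Z)).
Qed.

Lemma mate_cap Z : cap A Z ∘ mate (A ⊗ Z) = cap' Z ∘ Gm (f Z).
Proof.
rewrite /mate.
chain (esym (cap'_nat (cap A Z))).
have e := congr1 (@Gm _ _) (esym (f_nat (cap A Z))).
rewrite !Gm_comp in e; chain e.
have z := congr1 (@Gm _ _) (zig A Z).
by rewrite Gm_comp Gm_id in z; chain z.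
Qed.

(** [cup_sw_over] rewrites the cup inside the mate as one already crossed by [A]; the crossing then
    moves through [f] by [f_sw] and out through [cap'] by [cap'_sw]. *)
Lemma mate_sw Z :
  sw A (dual_obj A) Z ∘ (A ◁ mate Z) = mate (A ⊗ Z) ∘ sG Z.
Proof.
rewrite /mate -(cup_sw_over A A Z) !Gm_comp.
chain (esym (sG_nat (cup A Z))).
have e1 := congr1 (@Gm _ _) (f_nat (sw A (dual_obj A) Z)).
rewrite !Gm_comp in e1; chain e1.
have e2 := congr1 (@Gm _ _) (f_sw (dual_obj A ⊗ Z)).
rewrite !Gm_comp in e2; chain e2.
chain (cap'_nat (sw A (dual_obj A) Z)).
chain (esym (sG_nat (f (dual_obj A ⊗ Z)))).
by chain (cap'_sw (dual_obj A ⊗ Z)).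
Qed.

(** [tcap] is a left-handed [cap] after a crossing and a twist: the twist acts on [A] alone and
    moves aside, the mate passes the crossing by [mate_sw] and is absorbed at the cap by
    [mate_cap]. *)
Lemma mate_tcap Z :
  tcap A Z ∘ (A ◁ mate Z) = cap' Z ∘ Gm (f Z) ∘ sG Z ∘ (twist A ▷ G Z).
Proof.
rewrite tcapE bcapE.
chain (whisk_exch (twist A) (mate Z)).
chain (mate_sw Z).
by chain (mate_cap Z).
Qed.

End Mate.

(** * Mates of a morphism and of the associator *)

Section MateInstances.
Context {K : fieldType} {C : ribbonCategory K}.
Implicit Types A B X Y Z W : C.

(** [m] is the transpose of [k]. The two equations carry [k] through a cup and back at the twisted
    evaluation; the second needs naturality of the twist. *)
Lemma mate_hom A B (k : hom B A) :
  exists m : forall Z, hom (dual_obj A ⊗ Z) (dual_obj B ⊗ Z),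
    (forall Z, (k ▷ (dual_obj B ⊗ Z)) ∘ cup B Z = (A ◁ m Z) ∘ cup A Z) /\
    (forall Z, tcap B Z ∘ (B ◁ m Z) = tcap A Z ∘ (k ▷ (dual_obj A ⊗ Z))).
Proof.
pose m := mate (A := B) (F := tens A) (G := tens (dual_obj A))
  (fun Z W h => dual_obj A ◁ h) (cap A) (fun Z => k ▷ Z).
exists m; split=> Z.
- apply: (mate_cup (Fm := fun Z W h => A ◁ h)) => *.
  + by rewrite whiskl_comp.
  + by rewrite cup_nat.
  + by rewrite zig.
- rewrite (mate_tcap (Fm := fun Z W h => A ◁ h)
      (sF := fun Z => sw B A Z) (sG := fun Z => sw B (dual_obj A) Z)) => *.
  + rewrite tcapE bcapE.
    chain (congr1 (fun f => f ▷ (dual_obj A ⊗ Z)) (twist_nat k)).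
    by chain (sw_natl (dual_obj A) Z k).
  + by rewrite whiskl_comp.
  + by rewrite tensm_id.
  + by rewrite cap_nat.
  + by rewrite whisk_exch.
  + by rewrite sw_natm.
  + by rewrite sw_nat.
  + by rewrite cap_sw_over.
Qed.

(** The double crossing of [X] and [Y] comes from the twist of [X ⊗ Y]. Yang-Baxter and sliding
    strands over evaluations remove every crossing between an [X] strand and a [Y] strand. *)
Lemma nested_bcap X Y Z :
  cap Y Z ∘ (dual_obj Y ◁ cap X (Y ⊗ Z)) ∘
    (dual_obj Y ◁ sw X (dual_obj X) (Y ⊗ Z)) ∘
    (dual_obj Y ◁ X ◁ sw Y (dual_obj X) Z) ∘
    sw X (dual_obj Y) (Y ⊗ (dual_obj X ⊗ Z)) ∘
    (X ◁ sw Y (dual_obj Y) (dual_obj X ⊗ Z)) ∘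
    sw Y X (dual_obj Y ⊗ (dual_obj X ⊗ Z)) ∘
    sw X Y (dual_obj Y ⊗ (dual_obj X ⊗ Z)) =
  bcap X Z ∘ (X ◁ bcap Y (dual_obj X ⊗ Z)).
Proof.
chain (esym (yang_baxter Y X (dual_obj Y) (dual_obj X ⊗ Z))).
have e := bcap_sw_over X Y Z; rewrite !bcapE in e.
chain (congr1 (fun f => dual_obj Y ◁ f) e).
chain (cap_nat Y (cap X Z ∘ sw X (dual_obj X) Z)).
have e' := bcap_sw_over Y X (dual_obj X ⊗ Z); rewrite !bcapE in e'.
by chain e'; rewrite !bcapE !whiskl_comp !compA.
Qed.

(** Nested cups and caps make the two dual strands adjoint to the strands [X], [Y]; [m] is the mate
    of the associator, comparing them with the chosen dual of [X ⊗ Y]. In the second equation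
    [nested_bcap] absorbs the double braiding produced by the twist. *)
Lemma mate_tens X Y (P := X ⊗ Y) :
  exists m : forall Z, hom (dual_obj Y ⊗ (dual_obj X ⊗ Z)) (dual_obj P ⊗ Z),
    (forall Z, assoc X Y (dual_obj P ⊗ Z) ∘ cup P Z =
       (X ◁ Y ◁ m Z) ∘ (X ◁ cup Y (dual_obj X ⊗ Z)) ∘ cup X Z) /\
    (forall Z, tcap P Z ∘ (P ◁ m Z) =
       tcap X Z ∘ (X ◁ tcap Y (dual_obj X ⊗ Z)) ∘ assoc X Y _).
Proof.
pose G Z := dual_obj Y ⊗ (dual_obj X ⊗ Z).
pose F Z := X ⊗ (Y ⊗ Z).
pose Gm Z W (h : hom Z W) : hom (G Z) (G W) := dual_obj Y ◁ dual_obj X ◁ h.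
pose Fm Z W (h : hom Z W) : hom (F Z) (F W) := X ◁ Y ◁ h.
pose cup' Z : hom Z (F (G Z)) := (X ◁ cup Y (dual_obj X ⊗ Z)) ∘ cup X Z.
pose cap' Z : hom (G (F Z)) Z := cap Y Z ∘ (dual_obj Y ◁ cap X (Y ⊗ Z)).
have Fm_comp U V W (g : hom V W) (h : hom U V) : Fm _ _ (g ∘ h) = Fm _ _ g ∘ Fm _ _ h.
  by rewrite /Fm !whiskl_comp.
have zig' Z : Fm _ _ (cap' Z) ∘ cup' (F Z) = idm (F Z).
  rewrite /Fm /cap' /cup' /F.
  chain (congr1 (fun f => X ◁ f) (esym (cup_nat Y (cap X (Y ⊗ Z))))).
  chain (congr1 (fun f => X ◁ f) (zig Y Z)).
  by chain (zig X (Y ⊗ Z)).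
have cup'_nat Z W (h : hom Z W) : cup' W ∘ h = Fm _ _ (Gm _ _ h) ∘ cup' Z.
  rewrite /cup'; chain (cup_nat X h).
  by chain (congr1 (fun f => X ◁ f) (cup_nat Y (dual_obj X ◁ h))).
exists (mate Gm cap' (fun Z => assoc X Y Z)); split=> Z.
- rewrite (mate_cup (Gm := Gm) (cup' := cup') (cap' := cap')
     (fun Z => assoc X Y Z) Fm_comp cup'_nat zig').
  by rewrite /cup' /Fm !compA.
- rewrite (mate_tcap (A := P) (Fm := Fm) (Gm := Gm) (cap' := cap')
     (f := fun Z => assoc X Y Z)
     (sF := fun Z => (X ◁ sw P Y Z) ∘ sw P X (Y ⊗ Z))
     (sG := fun Z => (dual_obj Y ◁ sw P (dual_obj X) Z) ∘
                     sw P (dual_obj Y) (dual_obj X ⊗ Z))) //.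
  + rewrite /cap' /Gm /P.
    chain (congr1 (fun f => dual_obj Y ◁ f) (esym (sw_tensl X Y (dual_obj X) Z))).
    chain (esym (sw_tensl X Y (dual_obj Y) (dual_obj X ⊗ Z))).
    chain (twist_tens_strand X Y (dual_obj Y ⊗ (dual_obj X ⊗ Z))).
    chain (nested_bcap X Y Z).
    rewrite !tcapE.
    by chain (whisk_exch (twist X) (bcap Y (dual_obj X ⊗ Z))).
  + by move=> U V W g h; rewrite /Gm !whiskl_comp.
  + by move=> U; rewrite /Gm !tensm_id.
  + move=> U V h; rewrite /cap' /Gm /Fm.
    chain (congr1 (fun f => dual_obj Y ◁ f) (cap_nat X (Y ◁ h))).
    by chain (cap_nat Y h).
  + by move=> U V h; rewrite /Fm /P assoc_natr.
  + move=> U; rewrite /P; chain (sw_tensr (X ⊗ Y) X Y U); by [].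
  + move=> U V h; rewrite /Gm.
    chain (sw_nat P (dual_obj Y) (dual_obj X ◁ h)).
    by chain (congr1 (fun f => dual_obj Y ◁ f) (sw_nat P (dual_obj X) h)).
  + move=> U; rewrite /cap' /Gm /F.
    chain (congr1 (fun f => dual_obj Y ◁ f) (cap_nat X (sw P Y U))).
    chain (congr1 (fun f => dual_obj Y ◁ f) (cap_sw_over X P (Y ⊗ U))).
    chain (esym (sw_nat P (dual_obj Y) (cap X (Y ⊗ U)))).
    by chain (cap_sw_over Y P U).
Qed.

End MateInstances.

(** * Traces as closed loops, and loops encircling a strand *)

Section Traces.
Context {K : fieldType} {C : ribbonCategory K}.
Implicit Types A B D X Y Z W : C.

Definition loop A (f : hom A A) Z : hom Z Z :=
  tcap A Z ∘ (f ▷ (dual_obj A ⊗ Z)) ∘ cup A Z.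

Lemma loop_tr A (f : hom A A) Z :
  loop f Z ∘ lunit Z = lunit Z ∘ (tr f ▷ Z).
Proof.
rewrite /loop /tr tcapE bcapE.
chain (cupE A Z).
chain (esym (assoc_natl (dual_obj A) Z f)).
chain (esym (assoc_natl (dual_obj A) Z (twist A))).
chain (sw_assoc A (dual_obj A) Z).
by chain (capE A Z).
Qed.

Lemma loop_scalar A (f : hom A A) c Z :
  tr f = c *: idm tunit -> loop f Z = c *: idm Z.
Proof.
move=> e; apply: (iso_cancelr (u := lunit Z)).
by rewrite loop_tr e tensmZl tensm_id compZr compZl comp_idl comp_idr.
Qed.

Lemma tr_scalar A (f : hom A A) c :
  loop f tunit = c *: idm tunit -> tr f = c *: idm tunit.
Proof.
move=> e; apply: whiskr_unit_inj; apply: (iso_cancell (u := lunit tunit)).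
by rewrite -loop_tr e tensmZl tensm_id compZr compZl comp_idl comp_idr.
Qed.

(** [k] travels around the loop: it becomes its mate at the cup and itself again at the twisted
    evaluation. *)
Lemma loop_cyclic A B (k : hom B A) (g : hom A B) Z :
  loop (g ∘ k) Z = loop (k ∘ g) Z.
Proof.
have [m [mcup mcap]] := mate_hom k.
rewrite /loop; chain (mcup Z).
chain (whisk_exch g (m Z)).
by chain (mcap Z).
Qed.

Lemma loop_sum A (J : finType) (f : J -> hom A A) Z :
  loop (\sum_j f j) Z = \sum_j loop (f j) Z.
Proof. by rewrite /loop tensm_suml comp_sumr comp_suml. Qed.

(** [A] is itself a dual of [B], with evaluation [tcap A] and coevaluation [cup']; the mate of the
    identity compares it with the chosen dual of [B]. A twist on [B] and an inverse twist on [A]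
    remain, and cancel by [twist_cup]. *)
Lemma loop_dual A Z : loop (idm (dual_obj A)) Z = loop (idm A) Z.
Proof.
pose B := dual_obj A.
(* The inverse crossing and inverse twist undo those contained in [tcap A], so that the zigzag
   [zig'] holds. *)
pose cup' W : hom W (B ⊗ (A ⊗ W)) :=
  (B ◁ iinv (twist A) ▷ W) ∘ iinv (sw B A W) ∘ cup A W.
have twV W : (twist A ▷ W) ∘ (iinv (twist A) ▷ W) = idm (A ⊗ W).
  by rewrite -whiskr_comp iinvK tensm_id.
have Vtw W : (iinv (twist A) ▷ W) ∘ (twist A ▷ W) = idm (A ⊗ W).
  by rewrite -whiskr_comp ihomK tensm_id.
have cup'_nat W W' (h : hom W W') : cup' W' ∘ h = (B ◁ A ◁ h) ∘ cup' W.
  have e : iinv (sw B A W') ∘ (A ◁ B ◁ h) = (B ◁ A ◁ h) ∘ iinv (sw B A W).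
    apply: (iso_cancell (u := sw B A W')); rewrite !compA iinvK comp_idl.
    by chain (sw_nat B A h); chain (iinvK (sw B A W)).
  rewrite /cup'; chain (cup_nat A h); chain e.
  by chain (congr1 (fun f => B ◁ f) (whisk_exch (iinv (twist A)) h)).
have zig' W : (B ◁ tcap A W) ∘ cup' (B ⊗ W) = idm (B ⊗ W).
  rewrite /cup' tcapE.
  chain (congr1 (fun f => B ◁ f) (twV (B ⊗ W))).
  chain (esym (bcap_sw_over A B W)).
  chain (iinvK (sw B A (B ⊗ W))).
  rewrite bcapE; chain (cup_sw_under A B W).
  by chain (zag A W).
pose m := mate (A := B) (F := tens B) (G := tens A)
  (fun Z W h => A ◁ h) (tcap A) (fun Z => idm (B ⊗ Z)).
have mcup W : cup B W = (B ◁ m W) ∘ cup' W.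
  rewrite -(mate_cup (Fm := fun Z W h => B ◁ h) (fun Z => idm (B ⊗ Z))) //.
  - by rewrite comp_idl.
  - by move=> *; rewrite whiskl_comp.
have mcap W : tcap B W ∘ (B ◁ m W) =
    tcap A W ∘ sw B A W ∘ (twist B ▷ (A ⊗ W)).
  rewrite (mate_tcap (Fm := fun Z W h => B ◁ h)
    (sF := fun Z => sw B B Z) (sG := fun Z => sw B A Z)) => *.
  - by rewrite tensm_id comp_idr.
  - by rewrite whiskl_comp.
  - by rewrite tensm_id.
  - by rewrite tcap_nat.
  - by rewrite comp_idl comp_idr.
  - by rewrite tensm_id comp_idl comp_idr.
  - by rewrite sw_nat.
  - by rewrite tcap_sw_over.
rewrite /loop !tensm_id !comp_idr (mcup Z); chain (mcap Z).
rewrite /cup'.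
chain (whisk_exch (twist B) (iinv (twist A) ▷ Z)).
chain (sw_natm B Z (iinv (twist A))).
chain (sw_natl A Z (twist B)).
chain (iinvK (sw B A Z)).
chain (esym (twist_cup A Z)).
by chain (Vtw (B ⊗ Z)).
Qed.

Lemma mate_tens_inv X Y (P := X ⊗ Y) :
  exists m : forall Z, hom (dual_obj Y ⊗ (dual_obj X ⊗ Z)) (dual_obj P ⊗ Z),
    (forall Z, assoc X Y (dual_obj P ⊗ Z) ∘ cup P Z =
       (X ◁ Y ◁ m Z) ∘ (X ◁ cup Y (dual_obj X ⊗ Z)) ∘ cup X Z) /\
    (forall Z, tcap P Z ∘ iinv (assoc X Y (dual_obj P ⊗ Z)) ∘ (X ◁ Y ◁ m Z) =
       tcap X Z ∘ (X ◁ tcap Y (dual_obj X ⊗ Z))).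
Proof.
have [m [mcup mcap]] := mate_tens X Y; exists m; split=> // Z.
apply: (iso_cancelr (u := assoc X Y _)).
chain (esym (assoc_natr X Y (m Z))).
chain (ihomK (assoc X Y (dual_obj P ⊗ Z))).
by chain (mcap Z).
Qed.

(** [g] is [f] in nested form. The comparison map between duals replaces the single loop by two
    nested ones. *)
Lemma loop_tens X Y (f : hom (X ⊗ Y) (X ⊗ Y))
    (g : forall Z, hom (X ⊗ (Y ⊗ Z)) (X ⊗ (Y ⊗ Z))) Z :
  (forall W, assoc X Y W ∘ (f ▷ W) = g W ∘ assoc X Y W) ->
  (forall W W' (h : hom W W'), g W' ∘ (X ◁ Y ◁ h) = (X ◁ Y ◁ h) ∘ g W) ->
  loop f Z = tcap X Z ∘ (X ◁ tcap Y (dual_obj X ⊗ Z)) ∘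
    g (dual_obj Y ⊗ (dual_obj X ⊗ Z)) ∘ (X ◁ cup Y (dual_obj X ⊗ Z)) ∘ cup X Z.
Proof.
move=> fg g_nat; have [m [mcup mcap]] := mate_tens_inv X Y.
chain (esym (mcap Z)).
chain (esym (g_nat _ _ (m Z))).
chain (esym (mcup Z)).
chain (esym (fg (dual_obj (X ⊗ Y) ⊗ Z))).
by chain (ihomK (assoc X Y (dual_obj (X ⊗ Y) ⊗ Z))).
Qed.

Lemma loop_tens_id X Y c d Z :
  (forall W, loop (idm X) W = c *: idm W) ->
  (forall W, loop (idm Y) W = d *: idm W) ->
  loop (idm (X ⊗ Y)) Z = (c * d) *: idm Z.
Proof.
move=> ec ed; rewrite (loop_tens (g := fun W => idm _)).
- move: (ed (dual_obj X ⊗ Z)) (ec Z); rewrite /loop !tensm_id !comp_idr => ed' ec'.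
  rewrite -(compA (tcap X Z)) -whiskl_comp ed' tensmZr tensm_id compZr comp_idr.
  by rewrite compZl ec' scalerA mulrC.
- by move=> W; rewrite tensm_id comp_idl comp_idr.
- by move=> W W' h; rewrite comp_idl comp_idr.
Qed.

(* The strand D encircled by a loop of f : A -> A. *)
Definition encircle D A (f : hom A A) Z : hom (D ⊗ Z) (D ⊗ Z) :=
  (D ◁ tcap A Z) ∘ (D ◁ f ▷ (dual_obj A ⊗ Z)) ∘
  sw A D (dual_obj A ⊗ Z) ∘ sw D A (dual_obj A ⊗ Z) ∘ (D ◁ cup A Z).

Lemma encircle_sum D A (J : finType) (f : J -> hom A A) Z :
  encircle D (\sum_j f j) Z = \sum_j encircle D (f j) Z.
Proof. by rewrite /encircle tensm_suml tensm_sumr comp_sumr !comp_suml. Qed.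

Lemma encircle_cyclic D A B (k : hom B A) (g : hom A B) Z :
  encircle D (g ∘ k) Z = encircle D (k ∘ g) Z.
Proof.
have [m [mcup mcap]] := mate_hom k.
rewrite /encircle.
chain (esym (sw_natl D (dual_obj B ⊗ Z) k)).
chain (esym (sw_natm D (dual_obj B ⊗ Z) k)).
chain (congr1 (fun f => D ◁ f) (mcup Z)).
chain (sw_nat D A (m Z)).
chain (sw_nat A D (m Z)).
chain (congr1 (fun f => D ◁ f) (whisk_exch g (m Z))).
by chain (congr1 (fun f => D ◁ f) (mcap Z)).
Qed.

(** The loop splits into two concentric ones: [mate_tens_inv] splits its cup and cap, [sw_tensr] and
    [sw_tensl] its crossings with [D]. *)
Lemma encircle_tens D X Y Z :
  encircle D (idm (X ⊗ Y)) Z =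
  (D ◁ tcap X Z) ∘ sw X D (dual_obj X ⊗ Z) ∘
  (X ◁ encircle D (idm Y) (dual_obj X ⊗ Z)) ∘
  sw D X (dual_obj X ⊗ Z) ∘ (D ◁ cup X Z).
Proof.
have [m [mcup mcap]] := mate_tens_inv X Y.
rewrite /encircle !tensm_id !comp_idr.
have tc := sw_nat X D (tcap Y (dual_obj X ⊗ Z)).
chain tc.
chain (congr1 (fun f => D ◁ f) (esym (mcap Z))).
chain (esym (sw_nat D X (cup Y (dual_obj X ⊗ Z)))).
chain (esym (sw_nat X D (Y ◁ m Z))).
chain (congr1 (fun f => X ◁ f) (esym (sw_nat Y D (m Z)))).
chain (congr1 (fun f => X ◁ f) (esym (sw_nat D Y (m Z)))).
chain (esym (sw_nat D X (Y ◁ m Z))).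
chain (congr1 (fun f => D ◁ f) (esym (mcup Z))).
chain (sw_tensr D X Y (dual_obj (X ⊗ Y) ⊗ Z)).
chain (sw_tensl X Y D (dual_obj (X ⊗ Y) ⊗ Z)).
by chain (congr1 (fun f => D ◁ f) (ihomK (assoc X Y (dual_obj (X ⊗ Y) ⊗ Z)))).
Qed.

Lemma encircle_nat D A Z Z' (h : hom Z Z') :
  encircle D (idm A) Z' ∘ (D ◁ h) = (D ◁ h) ∘ encircle D (idm A) Z.
Proof.
rewrite /encircle !tensm_id !comp_idr.
chain (congr1 (fun f => D ◁ f) (cup_nat A h)).
chain (sw_nat D A (dual_obj A ◁ h)).
chain (sw_nat A D (dual_obj A ◁ h)).
by chain (congr1 (fun f => D ◁ f) (tcap_nat A h)).
Qed.

Lemma encircle_tail D A Z W :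
  encircle D (idm A) (Z ⊗ W) ∘ assoc D Z W =
  assoc D Z W ∘ (encircle D (idm A) Z ▷ W).
Proof.
rewrite /encircle !tensm_id !comp_idr.
chain (congr1 (fun f => D ◁ f) (esym (cup_tail A Z W))).
chain (esym (assoc_natm D W (cup A Z))).
chain (sw_nat D A (assoc (dual_obj A) Z W)).
chain (sw_tail D A (dual_obj A ⊗ Z) W).
chain (sw_nat A D (assoc (dual_obj A) Z W)).
chain (sw_tail A D (dual_obj A ⊗ Z) W).
chain (congr1 (fun f => D ◁ f) (tcap_tail A Z W)).
by chain (esym (assoc_natm D W (tcap A Z))).
Qed.

(** Naturality and [encircle_tail] reduce every tail to [tunit], where encircling is, up to [runit],
    an endomorphism of [D]; hence one [c] serves all [Z]. *)
Lemma encircle_scalar D A :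
  (forall f : hom D D, exists c, f = c *: idm D) ->
  exists c, forall Z, encircle D (idm A) Z = c *: idm (D ⊗ Z).
Proof.
move=> endD.
have [c ec] := endD (runit D ∘ encircle D (idm A) tunit ∘ iinv (runit D)).
have e1 : encircle D (idm A) tunit = c *: idm (D ⊗ tunit).
  apply: (iso_cancell (u := runit D)); apply: (iso_cancelr (u := inv_iso (runit D))).
  by rewrite /= ec !compZr !compZl comp_idr iinvK.
exists c => Z; apply: (iso_cancelr (u := whiskl_iso D (lunit Z))) => /=.
rewrite encircle_nat; suff -> : encircle D (idm A) (tunit ⊗ Z) = c *: idm _.
  by rewrite compZr compZl comp_idl comp_idr.
apply: (iso_cancelr (u := assoc D tunit Z)).
by rewrite encircle_tail e1 tensmZl tensm_id compZr compZl comp_idl comp_idr.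
Qed.

(** In the Hopf link, opened by [loop_tens], the [Y] component is a loop around the strand [X] and
    contributes the factor [c]. *)
Lemma loop_hopf X Y c Z :
  (forall W, encircle X (idm Y) W = c *: idm (X ⊗ W)) ->
  loop (braid Y X ∘ braid X Y) Z = c *: loop (idm X) Z.
Proof.
move=> ec.
rewrite (loop_tens (g := fun W => sw Y X W ∘ sw X Y W)).
- have := ec (dual_obj X ⊗ Z); rewrite /encircle /loop !tensm_id !comp_idr => e.
  by chain e; rewrite compZr compZl comp_idr.
- move=> W; chain (sw_assoc X Y W).
  by chain (sw_assoc Y X W).
- by move=> W W' h; chain (sw_nat X Y h); chain (sw_nat Y X h).
Qed.

End Traces.

(** * Linear algebra of the fusion rules, with [t] the inverse of [s] *)

Section VerlindeAlgebra.
Variables (K : fieldType) (I : finType) (o : I) (star : I -> I).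
Variables (N : I -> I -> I -> nat) (s t : I -> I -> K) (d theta : I -> K).

Hypothesis st : forall i k, \sum_r s i r * t r k = (i == k)%:R.
Hypothesis ts : forall i k, \sum_r t i r * s r k = (i == k)%:R.
Hypothesis s_sym : forall i j, s i j = s j i.
Hypothesis s0 : forall j, s o j = d j.
Hypothesis s_fusion : forall i j r,
  s i r * s j r = d r * \sum_k (N i j k)%:R * s k r.
Hypothesis N0 : forall i j, N i j o = (j == star i).
Hypothesis N000 : N o o o != 0%N.
Hypothesis d0 : d o * d o = d o.
Hypothesis d_star : forall i, d (star i) = d i.
Hypothesis theta_neq0 : forall i, theta i != 0.
Hypothesis theta0 : theta o = 1.
Hypothesis balance : forall i j,
  theta i * theta j * s i j = \sum_k (N i j k)%:R * (theta k * d k).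

(** The factor relating row [r] of [t] to [s] in [s_inv_star]; independent of [r] by [a_const]. *)
Let a r := t r o / d r.

(** If [d r] vanished, [s_fusion] with equal indices would make every [s i r] square to zero,
    contradicting the invertibility of [s]. *)
Lemma d_neq0 r : d r != 0.
Proof.
apply/eqP => dr0.
have sr0 i : s r i = 0.
  by apply/eqP; have := s_fusion i i r; rewrite dr0 mul0r s_sym => /eqP; rewrite mulf_eq0 orbb.
have := st r r; rewrite eqxx big1 => [/esym/eqP|i _]; last by rewrite sr0 mul0r.
by rewrite oner_eq0.
Qed.

Lemma sum_delta (k : I) (F : I -> K) : \sum_j F j * (j == k)%:R = F k.
Proof.
rewrite (bigD1 k) //= eqxx mulr1 big1 ?addr0 // => j /negPf ->.
by rewrite mulr0.
Qed.

Lemma fusion_diag i j k :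
  (N i j k)%:R = \sum_r s i r * s j r / d r * t r k.
Proof.
rewrite -(sum_delta k (fun l => (N i j l)%:R)).
under eq_bigr => l _ do rewrite -st mulr_sumr.
rewrite exchange_big /=; apply: eq_bigr => r _.
rewrite s_fusion [d r * _]mulrC mulfK ?d_neq0 // mulr_suml.
by apply: eq_bigr => l _; rewrite mulrA.
Qed.

(** The expression in [fusion_diag] is symmetric in [i] and [j]; both coefficients are 0 or 1, so
    their equality in [K] is enough. *)
Lemma N0_sym i j : (j == star i) = (i == star j).
Proof.
have e : (N i j o)%:R = (N j i o)%:R :> K.
  by rewrite !fusion_diag; apply: eq_bigr => r _; rewrite [s i r * _]mulrC.
move: e; rewrite !N0.
by case: (j == _); case: (i == _) => // /eqP; rewrite mulr1n mulr0n ?(eq_sym (0 : K)) oner_eq0.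
Qed.

Lemma starK : involutive star.
Proof. by move=> i; apply/esym/eqP; rewrite -N0_sym. Qed.

Lemma star0 : star o = o.
Proof. by move: N000; rewrite N0; case: (o =P star o) => [<-|]. Qed.

(** The indicator of [star j] is a fusion coefficient onto [o]; expanding it by [fusion_diag] leaves
    a contraction of [t] with [s]. *)
Lemma s_inv_star m j : t m (star j) = a m * s j m.
Proof.
rewrite -(sum_delta (star j) (t m)).
under eq_bigr => i _ do rewrite -N0 fusion_diag mulr_sumr.
rewrite exchange_big /=.
transitivity (\sum_r (a r * s j r) * (r == m)%:R); last exact: sum_delta.
apply: eq_bigr => r _; rewrite eq_sym -ts mulr_sumr.
by apply: eq_bigr => i _; rewrite /a; ring.
Qed.

Lemma t_sym i j : t i j = t j i.
Proof.
rewrite -(sum_delta j (t i)).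
under eq_bigr => l _ do rewrite eq_sym -ts mulr_sumr.
rewrite exchange_big /=.
transitivity (\sum_r t j r * (r == i)%:R); last exact: sum_delta.
apply: eq_bigr => r _; rewrite eq_sym -ts mulr_sumr.
by apply: eq_bigr => l _; rewrite (s_sym r l); ring.
Qed.

(** The entry of the symmetric [t] at [o] and [star i] equals both [a o * d i] and
    [a (star i) * d (star i)]; cancel the dimension. *)
Lemma a_const j : a j = a o.
Proof.
have e i : a (star i) = a o.
  apply: (mulIf (d_neq0 i)).
  by rewrite -[in RHS]s0 s_sym -s_inv_star t_sym -d_star /a divfK ?d_neq0.
by rewrite -(starK j).
Qed.

Lemma s_invE r k : t r k = a o * s (star k) r.
Proof. by rewrite -{1}(starK k) s_inv_star a_const. Qed.

Lemma a0_neq0 : a o != 0.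
Proof.
apply/eqP => a0; have := ts o o; rewrite eqxx big1 => [/esym/eqP|r _].
  by rewrite oner_eq0.
by rewrite s_invE a0 !mul0r.
Qed.

Lemma d0_eq1 : d o = 1.
Proof. by apply: (mulfI (d_neq0 o)); rewrite d0 mulr1. Qed.

Lemma sum_d_s r : \sum_j d j * s j r = (a o)^-1 * (r == o)%:R.
Proof.
rewrite eq_sym -ts mulr_sumr; apply: eq_bigr => j _.
by rewrite t_sym s_invE star0 s0 -mulrA mulKf // a0_neq0.
Qed.

(** After diagonalisation [sum_d_s] keeps only the term [r = o]. *)
Lemma sum_d_fusion i k : \sum_j d j * (N i j k)%:R = d i * d k.
Proof.
under eq_bigr => j _ do rewrite fusion_diag mulr_sumr.
rewrite exchange_big /=.
transitivity (\sum_r (s i r / d r * t r k * (a o)^-1) * (r == o)%:R).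
  apply: eq_bigr => r _; rewrite -mulrA -sum_d_s mulr_sumr.
  by apply: eq_bigr => j _; ring.
rewrite sum_delta s_invE s_sym s0 d0_eq1 s_sym s0 d_star.
by field; rewrite a0_neq0 oner_neq0.
Qed.

Let pp := \sum_k theta k * d k ^+ 2.
Let pm := \sum_k (theta k)^-1 * d k ^+ 2.

Lemma sum_theta_s i : \sum_j theta j * d j * s i j = (theta i)^-1 * d i * pp.
Proof.
transitivity (\sum_j \sum_k (theta i)^-1 * (theta k * d k) * (d j * (N i j k)%:R)).
  apply: eq_bigr => j _.
  have -> : theta j * d j * s i j = (theta i)^-1 * d j * (theta i * theta j * s i j).
    by field; rewrite theta_neq0.
  by rewrite balance mulr_sumr; apply: eq_bigr => k _; ring.
rewrite exchange_big /= /pp mulr_sumr; apply: eq_bigr => k _.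
by rewrite -mulr_sumr sum_d_fusion; ring.
Qed.

(** Two evaluations of the double sum of [theta j * d j * d i * s i j]: over [j] first,
    [sum_theta_s] gives the product of Gauss sums; over [i] first, [sum_d_s] leaves only [j = o]. *)
Lemma gauss_sums : pp * pm = (a o)^-1.
Proof.
rewrite /pm mulr_sumr.
transitivity (\sum_i \sum_j theta j * d j * (d i * s i j)).
  apply: eq_bigr => i _.
  have -> : pp * ((theta i)^-1 * d i ^+ 2) = d i * ((theta i)^-1 * d i * pp) by ring.
  by rewrite -sum_theta_s mulr_sumr; apply: eq_bigr => j _; ring.
rewrite exchange_big /=.
transitivity (\sum_j (theta j * d j * (a o)^-1) * (j == o)%:R).
  by apply: eq_bigr => j _; rewrite -mulr_sumr sum_d_s mulrA.
by rewrite sum_delta theta0 d0_eq1 !mul1r.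
Qed.

Lemma verlinde_algebra D i j k : D ^+ 2 = pp * pm ->
  (N i j k)%:R = \sum_r (D^-1 * s i r) * (D^-1 * s j r) * (D^-1 * s (star k) r)
                          / (D^-1 * s o r).
Proof.
rewrite gauss_sums => D2.
have D0 : D != 0 by rewrite -sqrf_eq0 D2 invr_eq0 a0_neq0.
(* Three factors [D^-1] over one leave the square of [D^-1], exactly the constant turning
   [s (star k) r] into [t r k]. *)
have ao : a o = D^-1 ^+ 2 by rewrite exprVn D2 invrK.
rewrite fusion_diag; apply: eq_bigr => r _.
rewrite s_invE ao s0; field.
by rewrite D0 d_neq0.
Qed.

End VerlindeAlgebra.

(** * Scalar endomorphisms, the unit object, and bending of strands *)

Section Scalars.
Context {K : fieldType} {C : ribbonCategory K}.
Implicit Types A X Y Z : C.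

Lemma scale_id_inj X : idm X <> 0 -> injective (fun c : K => c *: idm X).
Proof.
move=> X0 a b /= /eqP; rewrite -subr_eq0 -scalerBl scaler_eq0 subr_eq0.
by case/orP => /eqP.
Qed.

Lemma scalar_of_unique X (f : hom X X) c :
  idm X <> 0 -> f = c *: idm X -> scalar_of f = c.
Proof.
move=> X0 e; apply: xget_unique => // a /= ea.
by apply: (scale_id_inj X0); rewrite -e -ea.
Qed.

(** Used for [V o = tunit], an equality of objects along which morphisms must be moved. *)
Definition eq_iso A B (e : A = B) : iso A B :=
  match e with erefl => Iso (comp_idl (idm A)) (comp_idl (idm A)) end.

(** The twist of [tunit ⊗ A] equals [tunit ◁ twist A] by naturality along [lunit]; comparison with
    [twist_tens] cancels the twist. *)
Lemma double_braid_unit A : braid A tunit ∘ braid tunit A = idm (tunit ⊗ A).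
Proof.
apply: (iso_cancelr (u := whiskl_iso tunit (twist A))) => /=.
have := twist_tens (tunit : C) A; rewrite twist_unit => <-.
rewrite comp_idl; apply: (iso_cancell (u := lunit A)).
by rewrite -twist_nat lunit_nat.
Qed.

(* The image of f : 1 -> X ⊗ Y under Hom(1, X ⊗ Y) ≅ Hom(X^*, Y). *)
Definition bend X Y (f : hom tunit (X ⊗ Y)) : hom (dual_obj X) Y :=
  cap X Y ∘ (dual_obj X ◁ f) ∘ iinv (runit (dual_obj X)).

Lemma bend_inj X Y : injective (@bend X Y).
Proof.
move=> f g e.
have {}e : cap X Y ∘ (dual_obj X ◁ f) = cap X Y ∘ (dual_obj X ◁ g).
  by apply: (iso_cancelr (u := inv_iso (runit (dual_obj X)))).
have bendK h : (X ◁ (cap X Y ∘ (dual_obj X ◁ h))) ∘ cup X tunit = h.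
  by chain (esym (cup_nat X h)); chain (zig X Y).
by rewrite -[f]bendK -[g]bendK e.
Qed.

Lemma bendZ X Y c (f : hom tunit (X ⊗ Y)) : bend (c *: f) = c *: bend f.
Proof. by rewrite /bend tensmZr compZr compZl. Qed.

Lemma coev_neq0 X : idm X <> 0 -> coev X <> 0.
Proof.
move=> X0 e; apply: X0; rewrite -(iinvK (lunit X)) -zigzag e tensm0l.
by rewrite comp0r comp0l.
Qed.

End Scalars.

(** * Dimensions, Hopf link values and fusion rules of the simple objects *)

Section Semisimple.
Context {K : fieldType} {C : ribbonCategory K} {I : finType}.
Variables (V : I -> C) (o : I).
Hypothesis ssV : semisimple V.
Hypothesis V0 : V o = tunit.
Implicit Types A X Y Z : C.

Lemma idV_neq0 i : idm (V i) <> 0.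
Proof. by case: (ss_simple ssV i). Qed.

Lemma endV i (f : hom (V i) (V i)) : exists c, f = c *: idm (V i).
Proof. by have [g _ gK] := ss_end ssV i; exists (g f); rewrite gK. Qed.

Lemma id_unit_neq0 : idm (tunit : C) <> 0.
Proof. by rewrite -V0; apply: idV_neq0. Qed.

Lemma end_unit (f : hom (tunit : C) tunit) : exists c, f = c *: idm tunit.
Proof. by move: f; rewrite -V0; apply: endV. Qed.

Lemma tr_scalar_of X (f : hom X X) : tr f = scalar_of (tr f) *: idm tunit.
Proof.
have [c e] := end_unit (tr f).
by rewrite (scalar_of_unique id_unit_neq0 e).
Qed.

Lemma loopE X (f : hom X X) Z : loop f Z = scalar_of (tr f) *: idm Z.
Proof. exact: loop_scalar (tr_scalar_of f). Qed.

Lemma scalar_tr X (f : hom X X) c :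
  loop f tunit = c *: idm tunit -> scalar_of (tr f) = c.
Proof. by move=> /tr_scalar e; apply: scalar_of_unique id_unit_neq0 e. Qed.

Lemma scalar_tr_cyclic X Y (k : hom X Y) (g : hom Y X) :
  scalar_of (tr (g ∘ k)) = scalar_of (tr (k ∘ g)).
Proof. by apply: scalar_tr; rewrite loop_cyclic loopE. Qed.

Lemma qdim_iso X Y (u : iso X Y) : qdim X = qdim Y.
Proof. by rewrite /qdim -(ihomK u) scalar_tr_cyclic iinvK. Qed.

Lemma qdim_dual X : qdim (dual_obj X) = qdim X.
Proof. by apply: scalar_tr; rewrite loop_dual loopE. Qed.

Lemma qdim_tens X Y : qdim (X ⊗ Y) = qdim X * qdim Y.
Proof. by apply: scalar_tr; rewrite (loop_tens_id _ (loopE _) (loopE _)). Qed.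

Lemma qdim_unit_idem : qdim (V o) * qdim (V o) = qdim (V o).
Proof. by rewrite -qdim_tens V0; apply: qdim_iso; apply: lunit. Qed.

Lemma s_entry_sym i j : s_entry V i j = s_entry V j i.
Proof. exact: scalar_tr_cyclic. Qed.

Lemma s_entry0 j : s_entry V o j = qdim (V j).
Proof.
rewrite /s_entry V0 double_braid_unit.
exact: (qdim_iso (lunit (V j))).
Qed.

Lemma twistE i : twist (V i) = twist_scalar V i *: idm (V i) :> hom _ _.
Proof.
have [c e] := endV (twist (V i)).
by rewrite /twist_scalar (scalar_of_unique (@idV_neq0 i) e).
Qed.

Lemma twist_scalar_neq0 i : twist_scalar V i != 0.
Proof.
apply/eqP => t0; apply: (@idV_neq0 i).
by rewrite -(ihomK (twist (V i))) twistE t0 scale0r comp0r.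
Qed.

Lemma twist_scalar0 : twist_scalar V o = 1.
Proof.
apply: (scalar_of_unique (@idV_neq0 o)).
by rewrite scale1r V0 twist_unit.
Qed.

Lemma double_braid_scalar i A :
  exists c, forall Z, encircle (V i) (idm A) Z = c *: idm (V i ⊗ Z).
Proof. exact: encircle_scalar (@endV i). Qed.

(** At [A = V j] this is the quotient of [s_entry V i j] by [qdim (V i)], obtained without division,
    so that the nonvanishing of dimensions can be derived from its multiplicativity. *)
Definition hopf i A : K := projT1 (cid (double_braid_scalar i A)).

Lemma hopfE i A Z : encircle (V i) (idm A) Z = hopf i A *: idm (V i ⊗ Z).
Proof. by rewrite /hopf; case: cid. Qed.

Lemma hopf_unique i A c :
  encircle (V i) (idm A) tunit = c *: idm (V i ⊗ tunit) -> hopf i A = c.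
Proof.
move=> e; apply: (@scale_id_inj _ _ (V i ⊗ tunit)); last by rewrite -e -hopfE.
move=> i0; apply: (@idV_neq0 i).
by rewrite -(iinvK (runit (V i))) -[ihom (runit _)]comp_idr i0 comp0r comp0l.
Qed.

Lemma s_entry_hopf i j : s_entry V i j = hopf i (V j) * qdim (V i).
Proof.
by apply: scalar_tr; rewrite (loop_hopf _ (hopfE _ _)) loopE scalerA.
Qed.

Lemma hopf_tens i X Y : hopf i (X ⊗ Y) = hopf i X * hopf i Y.
Proof.
apply: hopf_unique; rewrite encircle_tens hopfE tensmZr tensm_id.
rewrite compZr !compZl comp_idr mulrC -scalerA -hopfE.
by rewrite /encircle !tensm_id comp_idr.
Qed.

(** The label is cut into the terms [inj j ∘ prj j], and cyclicity turns each into the identity of a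
    summand. *)
Lemma hopf_direct_sum i (J : finType) (F : J -> C) X :
  is_direct_sum F X -> hopf i X = \sum_j hopf i (F j).
Proof.
move=> [inj [prj [prj_inj _ sum_id]]]; apply: hopf_unique.
rewrite -sum_id encircle_sum scaler_suml; apply: eq_bigr => j _.
by rewrite encircle_cyclic prj_inj hopfE.
Qed.

Variables (N : I -> I -> I -> nat).
Hypothesis fusN : fusion_coefficients V N.

Lemma fusion_sum i j (F : I -> K) :
  \sum_(x : {k : I & 'I_(N i j k)}) F (tag x) = \sum_k (N i j k)%:R * F k.
Proof.
rewrite -(sig_big_dep xpredT (fun=> xpredT) (fun k (_ : 'I_(N i j k)) => F k)) /=.
by apply: eq_bigr => k _; rewrite sumr_const card_ord mulr_natl.
Qed.

Lemma s_entry_fusion i j r :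
  s_entry V i r * s_entry V j r =
  qdim (V r) * \sum_k (N i j k)%:R * s_entry V k r.
Proof.
have e : hopf r (V i) * hopf r (V j) = \sum_k (N i j k)%:R * hopf r (V k).
  by rewrite -hopf_tens (hopf_direct_sum r (fusN i j)) (fusion_sum i j (fun k => hopf r (V k))).
rewrite ![s_entry V _ r]s_entry_sym !s_entry_hopf mulrACA e.
under [in RHS]eq_bigr => k _ do rewrite s_entry_sym s_entry_hopf mulrA.
by rewrite -mulr_suml mulrA mulrC mulrA mulrAC.
Qed.

(** The trace of the twist of [V i ⊗ V j] is computed in two ways: through the double braiding, and
    over the simple summands. *)
Lemma s_entry_balance i j :
  twist_scalar V i * twist_scalar V j * s_entry V i j =
  \sum_k (N i j k)%:R * (twist_scalar V k * qdim (V k)).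
Proof.
rewrite -(fusion_sum i j (fun k => twist_scalar V k * qdim (V k))).
have [inj [prj [prj_inj _ sum_id]]] := fusN i j.
apply: (scale_id_inj id_unit_neq0); transitivity (loop (twist (V i ⊗ V j)) tunit).
  rewrite twist_tens !twistE tensmZl tensmZr tensm_id !compZr comp_idr.
  by rewrite -scalerA -scalerA -loopE /loop !tensmZl !compZr !compZl.
rewrite -[ihom (twist _)]comp_idl -sum_id comp_suml loop_sum scaler_suml.
apply: eq_bigr => x _.
rewrite -compA -twist_nat loop_cyclic -compA prj_inj comp_idr twistE.
by rewrite /loop tensmZl compZr compZl -/(loop _ _) loopE scalerA.
Qed.

(** Without a summand [V o], every component of [f] is a map between distinct simples, hence
    zero. *)
Lemma fusion_unit_neq0 i j (f : hom (V o) (V i ⊗ V j)) : f <> 0 -> N i j o != 0%N.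
Proof.
move=> f0; apply/eqP => N0; apply: f0.
have [inj [prj [_ _ sum_id]]] := fusN i j.
rewrite -[f]comp_idl -sum_id comp_suml big1 // => -[k c] _.
rewrite -compA; have [e|ko] := eqVneq o k.
  by exfalso; move: c; rewrite -e N0 => -[].
by rewrite (ss_hom0 ssV (elimN eqP ko) (prj (existT _ k c) ∘ f)) comp0r.
Qed.

Lemma fusion_ooo_neq0 : N o o o != 0%N.
Proof.
suff [f f0] : exists f : hom (V o) (V o ⊗ V o), f <> 0 by apply: fusion_unit_neq0 f0.
rewrite V0; exists (iinv (lunit tunit)) => e; apply: id_unit_neq0.
by rewrite -(iinvK (lunit tunit)) e comp0r.
Qed.

Variable star : I -> I.
Hypothesis starP : forall i, V (star i) ≅ dual_obj (V i).

Lemma qdim_star i : qdim (V (star i)) = qdim (V i).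
Proof. by have [u] := starP i; rewrite (qdim_iso u) qdim_dual. Qed.

Lemma fusion_unit_star i : N i (star i) o != 0%N.
Proof.
have [u] := starP i.
apply: (@fusion_unit_neq0 _ _ ((V i ◁ iinv u) ∘ coev (V i) ∘ eq_iso V0)).
move=> e; apply: (coev_neq0 (@idV_neq0 i)).
apply: (iso_cancelr (u := eq_iso V0)).
apply: (iso_cancell (u := whiskl_iso (V i) (inv_iso u))) => /=.
by rewrite compA e comp0l comp0r.
Qed.

(** Bending turns each copy of [V o] in [V i ⊗ V j] into a nonzero map from [V (star i)] to [V j].
    There is none unless [j = star i], and then any two are proportional, so at most one copy
    exists; [coev] provides one. *)
Lemma fusion_unit i j : N i j o = (j == star i) :> nat.
Proof.
have [inj [prj [prj_inj prj_inj0 _]]] := fusN i j.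
have [u] := starP i.
pose b (c : 'I_(N i j o)) : hom (V (star i)) (V j) :=
  bend (inj (Tagged _ c) ∘ iinv (eq_iso V0)) ∘ u.
have b_lin c c' x : b c' = x *: b c -> inj (Tagged _ c') = x *: inj (Tagged _ c).
  rewrite /b -compZl => /iso_cancelr; rewrite -bendZ => /bend_inj.
  by rewrite -compZl => /(iso_cancelr (u := inv_iso (eq_iso V0))).
have b_neq0 c : b c <> 0.
  move=> bc0; have := b_lin c c 0; rewrite scale0r scale0r => /(_ bc0) inj0.
  by apply: (@idV_neq0 o); rewrite -(prj_inj (Tagged _ c)) inj0 comp0r.
have [ji|ji] := eqVneq j (star i); last first.
  case E : (N i j o) => [|n] //; have lt0 : (0 < N i j o)%N by rewrite E.
  case: (b_neq0 (Ordinal lt0)); apply: (ss_hom0 ssV) => e.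
  by rewrite e eqxx in ji.
have b_prop c c' : exists x, b c' = x *: b c.
  move: (b c) (b c') (b_neq0 c); rewrite ji => m m' m0.
  have [x mx] := endV m; have [y my] := endV m'; exists (y / x).
  rewrite mx my scalerA divfK //; apply/eqP => x0.
  by apply: m0; rewrite mx x0 scale0r.
have c_eq (c c' : 'I_(N i j o)) : c = c'.
  have [//|cc'] := eqVneq c c'; have [x /b_lin e] := b_prop c c'.
  (* For distinct copies the inclusion of [c'] is a multiple of that of [c], which the projection to
     [c'] kills; this would make the identity of [V o] zero. *)
  have pi0 : prj (Tagged _ c') ∘ inj (Tagged _ c) = 0.
    by apply: prj_inj0; apply: contra cc'; rewrite eq_Tagged.
  case: (@idV_neq0 o); apply: etrans (esym (prj_inj (Tagged _ c'))) _.
  by rewrite e compZr; apply: etrans (scaler0 _ x); congr (_ *: _); exact: pi0.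
apply/eqP; rewrite eqn_leq lt0n ji fusion_unit_star andbT leqNgt.
apply/negP => lt1; move: c_eq; rewrite ji => c_eq.
by have /(congr1 val) := c_eq (Ordinal (ltnW lt1)) (Ordinal lt1).
Qed.

Lemma s_matrix_inverse : s_matrix V \in unitmx -> exists t : I -> I -> K,
  (forall i k, \sum_r s_entry V i r * t r k = (i == k)%:R) /\
  (forall i k, \sum_r t i r * s_entry V r k = (i == k)%:R).
Proof.
move=> sU; pose t i k := invmx (s_matrix V) (enum_rank i) (enum_rank k).
exists t; split=> i k.
- have := congr1 (fun A : 'M_ _ => A (enum_rank i) (enum_rank k)) (mulmxV sU).
  rewrite !mxE (inj_eq enum_rank_inj) => <-.
  rewrite (reindex _ (onW_bij _ (@enum_val_bij I))) /=.
  by apply: eq_bigr => r _; rewrite !mxE /t enum_valK enum_rankK.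
- have := congr1 (fun A : 'M_ _ => A (enum_rank i) (enum_rank k)) (mulVmx sU).
  rewrite !mxE (inj_eq enum_rank_inj) => <-.
  rewrite (reindex _ (onW_bij _ (@enum_val_bij I))) /=.
  by apply: eq_bigr => r _; rewrite !mxE /t enum_valK enum_rankK.
Qed.

End Semisimple.

Theorem mainTheorem2 (R : realType) (C : ribbonCategory R[i])
    (I : finType) (V : I -> C) (i0 : I) (modC : modular V i0)
    (star : I -> I) (starP : forall i, V (star i) ≅ dual_obj (V i))
    (N : I -> I -> I -> nat) (NP : fusion_coefficients V N)
    (D : R[i]) (D_sqrt : D ^+ 2 = p_plus V * p_minus V) (i j k : I) :
  (N i j k)%:R =
    \sum_(r : I) S_entry V D i r * S_entry V D j r * S_entry V D (star k) r
                 / S_entry V D i0 r.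
Proof.
have [ssV V0 sU] := modC.
have [t [st ts]] := s_matrix_inverse sU.
(* Here [s] is [s_entry V], [d] the dimension and [theta] the twist scalar of the simple objects. *)
apply: (verlinde_algebra st ts (s_entry_sym ssV V0) (s_entry0 ssV V0)
  (s_entry_fusion ssV V0 NP) (fusion_unit ssV V0 NP starP)
  (fusion_ooo_neq0 ssV V0 NP) (qdim_unit_idem ssV V0) (qdim_star ssV V0 starP)
  (twist_scalar_neq0 ssV) (twist_scalar0 ssV V0) (s_entry_balance ssV V0 NP)
  _ _ _ D_sqrt).
Qed.
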